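(* Let $\alpha \in (0,1)$, $p \in [1,\infty)$, let $\Omega \subset \mathbb{R}^n$ be open and bounded, and let $g \in S^{\alpha,p}(\mathbb{R}^n)$. If $u_j \rightharpoonup u$ in $S^{\alpha,p}_g(\Omega)$, then \[ \nabla^\alpha u_j \to \nabla^\alpha u \quad \text{(strongly) in } L^p((\Omega')^c;\mathbb{R}^n) \] for every open set $\Omega'\subset \mathbb{R}^n$ with $\Omega\Subset \Omega'$.
   Context: For a bounded Lipschitz function $\phi:\mathbb{R}^n\to\mathbb{R}$ (in particular $\phi\in C_c^\infty(\mathbb{R}^n)$) and $\alpha\in(0,1)$, the Riesz fractional gradient is \[ \nabla^\alpha \phi(x)=\mu_{n,\alpha}\int_{\mathbb{R}^n}\frac{\phi(y)-\phi(x)}{|y-x|^{n+\alpha}}\frac{y-x}{|y-x|}\,dy,\qquad \mu_{n,\alpha}=2^{\alpha}\pi^{-n/2}\frac{\Gamma((n+\alpha+1)/2)}{\Gamma((1-\alpha)/2)}. \] For $u\in L^1(\mathbb{R}^n)+L^\infty(\mathbb{R}^n)$, a function $v\in L^1_{loc}(\mathbb{R}^n;\mathbb{R}^n)$ is the weak $\alpha$-fractional gradient of $u$, written $v=\nabla^\alpha u$, if $\int_{\mathbb{R}^n} v\phi\,dx=-\int_{\mathbb{R}^n}u\nabla^\alpha\phi\,dx$ for all $\phi\in C_c^\infty(\mathbb{R}^n)$. $S^{\alpha,p}(\mathbb{R}^n)=\{u\in L^p(\mathbb{R}^n): \nabla^\alpha u\in L^p(\mathbb{R}^n;\mathbb{R}^n)\}$.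 For $g\in S^{\alpha,p}(\mathbb{R}^n)$, $S^{\alpha,p}_g(\Omega)=\{u\in S^{\alpha,p}(\mathbb{R}^n): u=g \text{ a.e. in } \Omega^c\}$. Complements are taken in $\mathbb{R}^n$. Weak convergence $u_j\rightharpoonup u$ in $S^{\alpha,p}_g(\Omega)$ means: $u_j,u\in S^{\alpha,p}_g(\Omega)$, $u_j\rightharpoonup u$ weakly in $L^p(\mathbb{R}^n)$ and $\nabla^\alpha u_j\rightharpoonup\nabla^\alpha u$ weakly in $L^p(\mathbb{R}^n;\mathbb{R}^n)$. The notation $\Omega\Subset\Omega'$ means that $\overline{\Omega}$ is compact and $\overline{\Omega}\subset\Omega'$. *)

(* Defs.v *)
From HB Require Import structures.
From mathcomp Require Import all_boot all_order all_algebra.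
From mathcomp Require Import all_classical all_reals all_analysis.
From mathcomp Require Import measurable_realfun lra.
From mathcomp Require Import measurable_realfun lra.
From mathcomp Require Import measurable_realfun lra.
From mathcomp Require Import measurable_realfun lra.
From mathcomp Require Import measurable_realfun lra.
From mathcomp Require Import lra.
From mathcomp Require Import lra.
From mathcomp Require Import lra.

Set Implicit Arguments.
Unset Strict Implicit.
Unset Printing Implicit Defensive.

Import Order.TTheory GRing.Theory Num.Theory.
Import numFieldNormedType.Exports.

Local Open Scope classical_set_scope.
Local Open Scope ring_scope.

(* The library puts no sigma-algebra on 'rV[T]_n; this is the product one,
   generated by the coordinates (for T = R it is the Borel sigma-algebra, see
   open_measurable_rV). *)
Definition measure_rV_display : measure_display -> measure_display.
Proof. exact. Qed.

Section measurable_rV.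
Context {d} {T : sigmaRingType d}.
Variable n : nat.

Let coors : 'I_n -> 'rV[T]_n -> T := fun i x => x ord0 i.

Let rV_set0 : g_sigma_preimage coors set0.
Proof. exact: sigma_algebra0. Qed.

Let rV_setC A : g_sigma_preimage coors A -> g_sigma_preimage coors (~` A).
Proof. exact: sigma_algebraC. Qed.

Let rV_bigcup (F : (set _)^nat) : (forall i, g_sigma_preimage coors (F i)) ->
  g_sigma_preimage coors (\bigcup_i (F i)).
Proof. exact: sigma_algebra_bigcup. Qed.

HB.instance Definition _ := @isMeasurable.Build (measure_rV_display d)
  'rV[T]_n (g_sigma_preimage coors) rV_set0 rV_setC rV_bigcup.

End measurable_rV.

Lemma measurable_coord d (T : sigmaRingType d) n (i : 'I_n) :
  measurable_fun [set: 'rV[T]_n] (fun x : 'rV[T]_n => x ord0 i).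
Proof.
move=> _ Y mY; rewrite setTI; apply: sub_sigma_algebra => /=.
rewrite -bigcup_seq/=; exists i => /=; first by rewrite mem_index_enum.
by exists Y => //; rewrite setTI.
Qed.

Lemma measurable_fun_coordP d1 d2 (T1 : measurableType d1)
    (T2 : measurableType d2) n (f : T1 -> 'rV[T2]_n) :
  (forall i, measurable_fun [set: T1] (fun x => f x ord0 i)) ->
  measurable_fun [set: T1] f.
Proof.
move=> mf _ A mA.
have : g_sigma_preimage (fun i => (fun v : 'rV[T2]_n => v ord0 i) \o f)
    `<=` measurable.
  apply: smallest_sub; first exact: sigma_algebra_measurable.
  case: n => [|n] in f mf A mA *; first by rewrite big_ord0.
  rewrite -bigcup_mkord_ord; apply: bigcup_sub => i Ii.
  by move=> B [C mC <-]; exact: mf.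
rewrite (g_sigma_preimage_comp (fun i (v : 'rV[T2]_n) => v ord0 i) f).
by apply; exists A.
Qed.

(* Lebesgue measure on 'rV[R]_n: the image of the n-fold product of
   lebesgue_measure, built one coordinate at a time. *)
Section lebesgue_rV.
Context {R : realType}.
Local Notation mR := (measurableTypeR R).

Definition rV_cons n (x : mR * 'rV[R]_n) : 'rV[R]_n.+1 :=
  row_mx (x.1)%:M x.2.

Lemma rV_cons0 n (x : mR * 'rV[R]_n) : rV_cons x ord0 ord0 = x.1.
Proof.
rewrite /rV_cons (_ : ord0 = lshift n (ord0 : 'I_1)); last exact/val_inj.
by rewrite (@row_mxEl R 1 1 n) mxE eqxx.
Qed.

Lemma rV_consS n (x : mR * 'rV[R]_n) (i : 'I_n) :
  rV_cons x ord0 (lift ord0 i) = x.2 ord0 i.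
Proof.
rewrite /rV_cons (_ : lift ord0 i = rshift 1 i); last exact/val_inj.
by rewrite (@row_mxEr R 1 1 n).
Qed.

Lemma measurable_rV_cons n : measurable_fun [set: mR * 'rV[R]_n] (@rV_cons n).
Proof.
apply: measurable_fun_coordP => i.
have [j ->|->] := unliftP ord0 i.
  under eq_fun do rewrite rV_consS.
  exact: (measurableT_comp (measurable_coord j) measurable_snd).
by under eq_fun do rewrite rV_cons0; exact: measurable_fst.
Qed.

Let rV_uncons n (v : 'rV[R]_n.+1) : mR * 'rV[R]_n :=
  (v ord0 ord0, \row_i v ord0 (lift ord0 i)).

Let measurable_rV_uncons n : measurable_fun [set: 'rV[R]_n.+1] (@rV_uncons n).
Proof.
apply: measurable_fun_pair; first exact: measurable_coord.
apply: measurable_fun_coordP => i.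
under eq_fun do rewrite mxE.
exact: measurable_coord.
Qed.

Let rV_consK n : cancel (@rV_cons n) (@rV_uncons n).
Proof.
move=> x; rewrite /rV_uncons rV_cons0 [RHS]surjective_pairing; congr pair.
by apply/rowP => i; rewrite mxE rV_consS.
Qed.

Section succ.
Variables (n : nat) (mu : {sigma_finite_measure set 'rV[R]_n -> \bar R}).

Let prod : {measure set (mR * 'rV[R]_n)%type -> \bar R} :=
  @product_measure1 _ _ mR 'rV[R]_n R lebesgue_measure mu.

Definition lebesgue_rVS : set 'rV[R]_n.+1 -> \bar R :=
  pushforward prod (@rV_cons n).

HB.instance Definition _ := Measure.copy lebesgue_rVS
  (measure_function_pushforward__canonical__measure_function_Measure
     prod (@measurable_rV_cons n)).

Let lebesgue_rVS_sigma_finite : sigma_finite setT lebesgue_rVS.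
Proof.
have /sigma_finiteP[F [TF ndF Foo]] := sigma_finiteT (@lebesgue_measure R).
have /sigma_finiteP[G [TG ndG Goo]] := sigma_finiteT mu.
exists (fun k => @rV_uncons n @^-1` (F k `*` G k)).
  apply/esym/seteqP; split => // v _.
  have [k _ Fk] : (\bigcup_k F k) (rV_uncons v).1 by rewrite -TF.
  have [l _ Gl] : (\bigcup_k G k) (rV_uncons v).2 by rewrite -TG.
  exists (maxn k l) => //; split.
    by move: Fk; exact/subsetPset/ndF/leq_maxl.
  by move: Gl; exact/subsetPset/ndG/leq_maxr.
move=> k; have [mFk Fky] := Foo k; have [mGk Gky] := Goo k.
have mFG : measurable (F k `*` G k) by exact: measurableX.
split; first by rewrite -[X in measurable X]setTI; exact: measurable_rV_uncons.
rewrite /lebesgue_rVS /pushforward -comp_preimage.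
rewrite (_ : _ \o _ = id); last by apply/funext => x; exact: rV_consK.
rewrite preimage_id [ltLHS](product_measure1E lebesgue_measure mu mFk mGk).
by rewrite lte_mul_pinfty// ge0_fin_numE.
Qed.

HB.instance Definition _ :=
  Measure_isSigmaFinite.Build _ _ _ lebesgue_rVS lebesgue_rVS_sigma_finite.

End succ.

Fixpoint lebesgue_rV n : {sigma_finite_measure set 'rV[R]_n -> \bar R} :=
  match n with
  | 0 => dirac (0 : 'rV[R]_0)
  | m.+1 => lebesgue_rVS (lebesgue_rV m)
  end.

Lemma lebesgue_rV_box n (A : 'I_n -> set mR) : (forall i, measurable (A i)) ->
  lebesgue_rV n [set x | forall i, A i (x ord0 i)] =
  (\prod_(i < n) lebesgue_measure (A i))%E.
Proof.
elim: n A => [|n IHn] A mA /=.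
  rewrite big_ord0 diracE (_ : _ \in _ = true)//.
  by apply/mem_set => -[].
rewrite /lebesgue_rVS /pushforward big_ord_recl -IHn//.
have mB : measurable [set x : 'rV[R]_n | forall i, A (lift ord0 i) (x ord0 i)].
  rewrite (_ : mkset _ = \bigcap_(i in [set: 'I_n])
      ((fun x : 'rV[R]_n => x ord0 i) @^-1` A (lift ord0 i))); last first.
    by apply/seteqP; split => x /= H i; [move=> _|]; exact: H.
  apply: fin_bigcap_measurable => // i _.
  by rewrite -[X in measurable X]setTI; apply: measurable_coord => //; exact: mA.
rewrite -[RHS](product_measure1E lebesgue_measure (lebesgue_rV n) (mA ord0) mB).
congr (_ _); apply/seteqP; split => -[x v] /= H.
  by split => [|i]; [have := H ord0; rewrite rV_cons0|
    have := H (lift ord0 i); rewrite rV_consS].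
by move=> i; have [j ->|->] := unliftP ord0 i;
  rewrite ?rV_consS ?rV_cons0; case: H.
Qed.

Lemma open_measurable_rV n (U : set 'rV[R]_n) : open U -> measurable U.
Proof.
move=> oU.
pose B (q : 'rV[rat]_n * nat) := [set x : 'rV[R]_n |
  forall i, ball (ratr (q.1 ord0 i) : R) q.2.+1%:R^-1 (x ord0 i)].
have mB q : measurable (B q).
  rewrite (_ : B q = \bigcap_(i in [set: 'I_n])
      ((fun x : 'rV[R]_n => x ord0 i) @^-1`
         ball (ratr (q.1 ord0 i) : R) q.2.+1%:R^-1)); last first.
    by apply/seteqP; split => x /= H i; [move=> _|]; exact: H.
  apply: fin_bigcap_measurable => // i _.
  rewrite -[X in measurable X]setTI; apply: measurable_coord => //.
  by apply: open_measurable; apply: ball_open; rewrite invr_gt0.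
rewrite (_ : U = \bigcup_(q in [set q | B q `<=` U]) B q).
  rewrite bigcup_mkcond; apply: countable_bigcupT_measurable => // q.
  by case: ifP.
apply/seteqP; split => [x Ux|x [q /= + Bqx]]; last exact.
have /nbhs_ballP[e /= e0 xeU] : nbhs x U by exact: open_nbhs_nbhs.
have [k ke] : exists k, k.+1%:R^-1 < e / 2 :> R.
  have [k _ +] := near_infty_natSinv_lt (PosNum (divr_gt0 e0 (ltr0n R 2))).
  by move=> /(_ k (leqnn k)); exists k.
have /choice[q qx] : forall i, exists q : rat,
    ball (ratr q : R) k.+1%:R^-1 (x ord0 i).
  move=> i; have [|q] := @rat_in_itvoo R (x ord0 i) (x ord0 i + k.+1%:R^-1).
    by rewrite ltrDl invr_gt0.
  rewrite in_itv/= => /andP[xq qx]; exists q.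
  rewrite /ball/= ltr_norml; move: (k.+1%:R^-1) xq qx => e1 xq qx; apply/andP; split; lra.
exists (\row_i q i, k); last by move=> i; rewrite mxE; exact: qx.
move=> y /= By; apply: xeU; split=> // i j; rewrite ord1.
rewrite (splitr e); apply: ball_triangle.
- by apply: ball_sym; apply: le_ball (qx j); exact: ltW.
- by have := By j; rewrite mxE; apply: le_ball; exact: ltW.
Qed.

End lebesgue_rV.

Section fractional_gradient.
Context {R : realType} {n : nat}.
Implicit Types (x y : 'rV[R]_n) (u g phi : 'rV[R]_n -> R)
  (v : 'rV[R]_n -> 'rV[R]_n) (A D Omega : set 'rV[R]_n) (alpha p : R).

Local Notation mu := (@lebesgue_rV R n).

(* The library's norm on 'rV[R]_n is the sup norm; it induces the same
   topology, but the kernel of the fractional gradient needs this one. *)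
Definition enorm x : R := Num.sqrt (\sum_(i < n) x ord0 i ^+ 2).

Definition Gamma (s : R) : R :=
  \int[lebesgue_measure]_(t in `]0, +oo[%classic) (t `^ (s - 1) * expR (- t)).

Definition riesz_cst alpha : R :=
  2 `^ alpha * pi `^ (- (n%:R / 2)) *
  (Gamma ((n%:R + alpha + 1) / 2) / Gamma ((1 - alpha) / 2)).

(* At y = x the integrand is 0, by the convention 0^-1 = 0. *)
Definition riesz_grad alpha phi x : 'rV[R]_n :=
  \row_(i < n) (riesz_cst alpha *
    \int[mu]_y ((phi y - phi x) / enorm (y - x) `^ (n%:R + alpha) *
                ((y - x) ord0 i / enorm (y - x)))).

Definition partial (i : 'I_n) phi : 'rV[R]_n -> R :=
  fun x => 'D_(delta_mx ord0 i) phi x.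

(* C^oo: for every list s of directions, the iterated partial derivative along
   s is continuous and can be differentiated once more in each direction. *)
Definition smooth phi := forall s : seq 'I_n,
  let f := foldr partial phi s in
  continuous f /\ forall (i : 'I_n) x, derivable f x (delta_mx ord0 i).

Definition test_function phi :=
  smooth phi /\ compact (closure [set x | phi x != 0]).

(* Elements of L^p are (Borel) functions, not classes modulo a.e. equality. *)
Definition Lp (p : \bar R) : set ('rV[R]_n -> R) := [set u | u \in Lfun mu p].

Definition LpV_norm D p v : \bar R :=
  'N[mu]_p%:E[EFin \o ((enorm \o v) \_ D)]%E.

Definition LpV p : set ('rV[R]_n -> 'rV[R]_n) :=
  [set v | measurable_fun setT v /\ (LpV_norm setT p v < +oo)%E].

Definition L1_loc v := measurable_fun setT v /\
  forall K, compact K -> (\int[mu]_(x in K) (enorm (v x))%:E < +oo)%E.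

Definition L1_plus_Loo u :=
  exists u1 u2, [/\ Lp 1%E u1, Lp +oo%E u2 & u = u1 \+ u2].

Definition is_weak_frac_grad alpha u v :=
  [/\ L1_plus_Loo u, L1_loc v &
    forall phi, test_function phi -> forall i : 'I_n,
      \int[mu]_x (v x ord0 i * phi x) =
      - \int[mu]_x (u x * riesz_grad alpha phi x ord0 i)].

(* A weak fractional gradient is unique up to a null set; frac_grad alpha u is
   some representative of it, when it exists. *)
Definition frac_grad alpha u : 'rV[R]_n -> 'rV[R]_n :=
  xget (fun=> 0) [set v | is_weak_frac_grad alpha u v].

Definition frac_sobolev alpha p : set ('rV[R]_n -> R) :=
  [set u | [/\ Lp p%:E u, exists v, is_weak_frac_grad alpha u v &
               LpV p (frac_grad alpha u)]].

Definition frac_sobolev_bdry alpha p g Omega : set ('rV[R]_n -> R) :=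
  [set u | frac_sobolev alpha p u /\
           {ae mu, forall x, (~` Omega) x -> u x = g x}].

(* Weak convergence in the space L of V-valued functions with (semi)norm N:
   convergence against every bounded linear functional. *)
Definition bounded_functional (V : lmodType R) (L : set ('rV[R]_n -> V))
    (N : ('rV[R]_n -> V) -> \bar R) (l : ('rV[R]_n -> V) -> R) :=
  (forall (a : R) f h, L f -> L h ->
     l (fun x => a *: f x + h x) = a * l f + l h) /\
  exists C : R, forall f, L f -> ((`|l f|)%:E <= C%:E * N f)%E.

Definition weak_cvg (V : lmodType R) (L : set ('rV[R]_n -> V))
    (N : ('rV[R]_n -> V) -> \bar R) (f_ : nat -> 'rV[R]_n -> V)
    (f : 'rV[R]_n -> V) :=
  [/\ forall j, L (f_ j), L f &
    forall l, bounded_functional L N l -> (fun j => l (f_ j)) @ \oo --> l f].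

Definition weak_cvg_Lp p (u_ : nat -> 'rV[R]_n -> R) u :=
  @weak_cvg R^o (Lp p%:E) (fun f => 'N[mu]_p%:E[EFin \o f]%E) u_ u.

Definition weak_cvg_LpV p (v_ : nat -> 'rV[R]_n -> 'rV[R]_n) v :=
  weak_cvg (LpV p) (LpV_norm setT p) v_ v.

Definition weak_cvg_frac_sobolev_bdry alpha p g Omega
    (u_ : nat -> 'rV[R]_n -> R) u :=
  [/\ forall j, frac_sobolev_bdry alpha p g Omega (u_ j),
      frac_sobolev_bdry alpha p g Omega u,
      weak_cvg_Lp p u_ u &
      weak_cvg_LpV p (fun j => frac_grad alpha (u_ j)) (frac_grad alpha u)].

Definition strong_cvg_LpV D p (v_ : nat -> 'rV[R]_n -> 'rV[R]_n) v :=
  LpV_norm D p (v_ j \- v) @[j --> \oo] --> 0%E.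

Definition compactly_contained Omega Omega' :=
  compact (closure Omega) /\ closure Omega `<=` Omega'.

End fractional_gradient.

(* Main.v *)
Require Import Defs.
From HB Require Import structures.
From mathcomp Require Import all_boot all_order all_algebra.
From mathcomp Require Import all_classical all_reals all_analysis.
From mathcomp Require Import measurable_realfun ring lra.

Set Implicit Arguments.
Unset Strict Implicit.
Unset Printing Implicit Defensive.

Import Order.TTheory GRing.Theory Num.Theory.
Import numFieldNormedType.Exports.

Local Open Scope classical_set_scope.
Local Open Scope ring_scope.

(** The difference w_j = u_j - u vanishes off Omega, so at positive distance from
    Omega its fractional gradient has no singularity: it is the potential
      F_j(x) = - mu_{n,alpha} \int_Omega w_j(y) k(x - y) dy,
      k(z) = z / |z|^(n + alpha + 1),
    as one sees by testing against bumps supported away from Omega and applying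
    Fubini. Weak convergence of u_j gives F_j(x) -> 0 for every x outside Omega'
    and, by uniform boundedness, a bound on the norms of w_j in L^1(Omega). Hence
    |F_j(x)| <= C (1 + |x|)^-(n + alpha), whose p-th power is integrable, and
    dominated convergence concludes. *)

(** * Integrability of the kernel *)

(** Weak convergence of u_j is exploited through the functionals f -> \int_Omega f k with k bounded
    and measurable. This class serves both uses: the kernel y -> k(x - y), once truncated at
    distance [eta], is bounded for every x, and the functions built in the uniform boundedness
    argument are bounded by construction. No L^p duality enters, and p = 1 needs no separate
    treatment.

    The weak definition of the gradient accounts for most of the length. It gives an identity
    against smooth functions only, and the integrals of u_j and of u against the Riesz gradient of a
    bump can be subtracted only once each integrand is integrable; hence the estimates placing that
    Riesz gradient in L^1 and L^oo. Bumps are products of one-variable functions supported in boxes,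
    so boxes and the sup norm take the place of balls. Moreover [frac_grad] is an arbitrary
    representative, so the formula for it is obtained almost everywhere on one small box at a time,
    and countably many boxes cover the complement of Omega'. *)

Section Kernel.
Context {R : realType} {n : nat}.
Implicit Types (x y z : 'rV[R]_n) (f : 'rV[R]_n -> R).
Local Notation mu := (@lebesgue_rV R n).

Lemma continuous_measurable_rV f : continuous f -> measurable_fun setT f.
Proof.
move=> /continuousP cf; apply: (measurability _ (RGenOpens.measurableE R)).
move=> _ [_ [a [b ->] <-]]; rewrite setTI.
by apply: open_measurable_rV; apply: cf; exact: interval_open.
Qed.

Lemma ler_coord_norm x i : `|x ord0 i| <= `|x|.
Proof.
by rewrite [leRHS]/Num.Def.normr /= mx_normrE; apply/bigmax_geP; right => /=; exists (ord0, i).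
Qed.

Lemma rV_norm_leP x (r : R) : 0 <= r ->
  reflect (forall i, `|x ord0 i| <= r) (`|x| <= r).
Proof.
move=> r0; apply: (iffP idP) => [xr i|xr].
  exact: le_trans (ler_coord_norm x i) xr.
rewrite [leLHS]/Num.Def.normr /= mx_normrE; apply: bigmax_le => // -[i j] _ /=.
by rewrite ord1; exact: xr.
Qed.

Lemma enorm_ge0 x : 0 <= enorm x. Proof. exact: sqrtr_ge0. Qed.

Lemma norm_le_enorm x : `|x| <= enorm x.
Proof.
apply/rV_norm_leP => [|i]; first exact: enorm_ge0.
rewrite -sqrtr_sqr ler_wsqrtr// (bigD1 i)//= lerDl.
by apply: sumr_ge0 => j _; exact: sqr_ge0.
Qed.

Lemma measurable_norm_rV : measurable_fun setT (fun x => `|x|).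
Proof. by apply: continuous_measurable_rV => x; exact: norm_continuous. Qed.

Lemma measurable_enorm : measurable_fun setT (@enorm R n).
Proof.
apply: continuous_measurable_rV => x.
apply: (@continuous_comp _ _ _ _ Num.sqrt); last exact: sqrt_continuous.
apply: (continuous_big (op := +%R)) => [|i _]; first exact: add_continuous.
move=> y; rewrite (_ : (fun x => _) = (fun x => x ord0 i * x ord0 i)); last first.
  by apply/funext => z; rewrite expr2.
by apply: continuousM; exact: coord_continuous.
Qed.

Lemma measurable_sub_rV d (T : measurableType d) (f1 f2 : T -> 'rV[R]_n) :
  measurable_fun setT f1 -> measurable_fun setT f2 ->
  measurable_fun setT (fun t => f1 t - f2 t).
Proof.
move=> m1 m2; apply: measurable_fun_coordP => i.
under eq_fun do rewrite !mxE.
by apply: measurable_funB; exact: (measurableT_comp (measurable_coord i)).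
Qed.

(* The size of the integrand of the fractional gradient of a bounded Lipschitz
   function at z = y - x; `|z| is the sup norm, which enorm dominates. *)
Definition kap (a : R) z : R :=
  Num.min 1 `|z| * `|z| `^ (- (n%:R + a)).

Lemma kap_ge0 a z : 0 <= kap a z.
Proof. by rewrite mulr_ge0// ?powR_ge0// le_min ler01 normr_ge0. Qed.

Lemma measurable_kap a : measurable_fun setT (kap a).
Proof.
apply: measurable_funM.
  by apply: measurable_minr => //; exact: measurable_norm_rV.
exact: (measurableT_comp (measurable_powR _) measurable_norm_rV).
Qed.

Definition cbox (x : 'rV[R]_n) (r : R) : set 'rV[R]_n := [set y | `|y - x| <= r].

Lemma measurable_cbox x r : measurable (cbox x r).
Proof.
rewrite (_ : cbox x r = (fun y => `|y - x|) @^-1` `]-oo, r]); last first.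
  by apply/seteqP; split => y /=; rewrite in_itv.
rewrite -[X in measurable X]setTI.
have := measurableT_comp measurable_norm_rV
  (measurable_sub_rV (@measurable_id _ _ setT) (@measurable_cst _ _ _ _ setT x)).
by apply.
Qed.

Lemma lebesgue_cbox x r : 0 <= r ->
  (mu : {measure set 'rV[R]_n -> \bar R}) (cbox x r) = ((2 * r) ^+ n)%:E.
Proof.
move=> r0.
rewrite (_ : cbox x r = [set y | forall i,
    [set` `[x ord0 i - r, x ord0 i + r]] (y ord0 i)]); last first.
  apply/seteqP; split => y /=.
    move=> /rV_norm_leP -/(_ r0) yr i; have := yr i.
    by rewrite !mxE in_itv/= ler_distl.
  move=> yr; apply/rV_norm_leP => // i; have := yr i.
  by rewrite !mxE in_itv/= ler_distl.
rewrite [LHS](@lebesgue_rV_box R n (fun i => [set` `[x ord0 i - r, x ord0 i + r]])); last first.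
  by move=> i; exact: measurable_itv.
transitivity (\prod_(i < n) (2 * r)%:E)%E.
  apply: eq_bigr => i _; rewrite lebesgue_measure_itv/= lte_fin.
  case: ltP => h; rewrite -?EFinD; congr (_ %:E); lra.
by rewrite prodEFin prodr_const card_ord.
Qed.

End Kernel.

Lemma dyadic_bracket {R : realType} (r : R) : 1 <= r ->
  exists k, 2 ^+ k <= r < 2 ^+ k.+1.
Proof.
move=> r1.
have ex : exists k, r < 2 ^+ k.
  exists (Num.bound r); apply: lt_le_trans (archi_boundP (le_trans ler01 r1)) _.
  by rewrite -natrX ler_nat ltnW// ltn_expl.
case: (ex_minnP ex) => -[|k] rk kmin.
  by move: rk; rewrite expr0 ltNge r1.
exists k; rewrite rk andbT leNgt; apply/negP => /kmin.
by rewrite ltnn.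
Qed.

Lemma powR2_lt1 {R : realType} (b : R) : b < 0 -> 2 `^ b < 1.
Proof.
move=> b0; rewrite -[b]opprK powRN invf_lt1 ?powR_gt0//.
rewrite [ltLHS](_ : 1 = 1 `^ (- b) :> R); last by rewrite powR1.
apply: gt0_ltr_powR; [lra|by rewrite nnegrE|by rewrite nnegrE|lra].
Qed.

Section KernelIntegral.
Context {R : realType} {n : nat}.
Implicit Types (x y z : 'rV[R]_n).
Local Notation mu := (@lebesgue_rV R n).

(* kap is dominated by constants on dyadic boxes. The measure of a box does not
   depend on its centre, so translation invariance of lebesgue_rV is not needed. *)
Let term (a : R) x (k : nat) y : \bar R :=
  (((2 `^ (n%:R + a - 1)) ^+ k)%:E * (\1_(cbox x (2 / 2 ^+ k)) y)%:E +
  ((2 `^ (- (n%:R + a))) ^+ k)%:E * (\1_(cbox x (2 * 2 ^+ k)) y)%:E)%E.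

Let term_ge0 a x k y : (0 <= term a x k y)%E.
Proof.
by rewrite /term -!EFinM -EFinD lee_fin addr_ge0// mulr_ge0// exprn_ge0// powR_ge0.
Qed.

(** One term suffices: the one whose dyadic shell contains y. The first summand serves the distances
    below 1, where [kap] is r^-(n + a - 1) and this exponent is negative because n >= 1; the second
    serves the distances at least 1. *)
Lemma kap_le_term a x y : (0 < n)%N -> 0 < a ->
  ((kap a (y - x))%:E <= \sum_(0 <= k <oo) term a x k y)%E.
Proof.
move=> n0 a0; have n1 : 1 <= n%:R :> R by rewrite ler1n.
set r := `|y - x|.
suff [k Hk] : exists k, ((kap a (y - x))%:E <= term a x k y)%E.
  apply: (le_trans Hk); apply: le_trans (nneseries_lim_ge k.+1 _) => //.
  by rewrite big_nat_recr//= leeDr// sume_ge0.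
have r0 : 0 <= r by exact: normr_ge0.
have [r00|rn0] := eqVneq r 0.
  exists 0%N; apply: le_trans (term_ge0 _ _ _ _).
  by rewrite /kap -/r r00 lee_fin minEle ler10 mul0r.
have rgt0 : 0 < r by rewrite lt_def rn0.
have [r1|r1] := leP 1 r.
  have [k /andP[kr rk]] := dyadic_bracket r1.
  exists k; rewrite /term /kap -/r min_l// mul1r.
  rewrite [leLHS](_ : _ = 0 + (r `^ (- (n%:R + a)))%:E)%E; last by rewrite add0e.
  rewrite leeD//.
  rewrite -EFinM lee_fin indicE mem_set ?mulr1; last first.
    by rewrite /cbox /= -/r; apply: ltW; rewrite -exprS.
  rewrite -powR_mulrn ?powR_ge0// -powRrM mulrC powRrM powR_mulrn//.
  rewrite !powRN lef_pV2 ?posrE ?powR_gt0 ?exprn_gt0//.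
  by apply: ge0_ler_powR; rewrite ?nnegrE ?exprn_ge0//; lra.
have [k /andP[kr rk]] : exists k, 2 ^+ k <= r^-1 < 2 ^+ k.+1.
  by apply: dyadic_bracket; rewrite invf_ge1// ltW.
(* The index is [k.+1] since the power is bounded through 1/r < 2^(k+1); the box of radius 2/2^(k+1)
   = 2^-k still contains y because 2^k <= 1/r. *)
exists k.+1; rewrite /term /kap -/r min_r; last exact: ltW.
rewrite [leLHS](_ : _ = (r `^ (- (n%:R + a - 1)))%:E + 0)%E; last first.
  rewrite adde0; congr (_ %:E).
  rewrite -{1}(@powRr1 _ r)// -powRD; last by apply/implyP.
  by congr (_ `^ _); ring.
rewrite leeD//.
rewrite -EFinM lee_fin indicE mem_set ?mulr1; last first.
  rewrite /cbox /= -/r exprS invfM mulrA divff// mul1r.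
  by rewrite -[r]invrK lef_pV2// posrE ?invr_gt0// exprn_gt0.
rewrite -[leRHS]powR_mulrn ?powR_ge0// -powRrM mulrC powRrM powR_mulrn//.
rewrite -[X in _ `^ X <= _]mulN1r powRrM powR_inv1//.
by apply: ge0_ler_powR; rewrite ?nnegrE ?exprn_ge0 ?invr_ge0//; [lra|exact: ltW].
Qed.

Lemma geometric_nneseries (q : R) : 0 < q -> q < 1 ->
  (\sum_(0 <= k <oo) (q ^+ k)%:E <= ((1 - q)^-1)%:E)%E.
Proof.
move=> q0 q1; apply: lime_le.
  by apply: is_cvg_nneseries => k _ _; rewrite lee_fin exprn_ge0// ltW.
near=> k; rewrite sumEFin lee_fin.
have q1' : `|q| < 1 by rewrite gtr0_norm.
have := geometric_le_lim k ler01 q0 q1'; rewrite mul1r.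
by apply: le_trans => //; rewrite /series/=; apply: ler_sum => i _; rewrite mul1r.
Unshelve. all: by end_near. Qed.

(** The boxes of index k have measures (4 / 2^k)^n and (4 2^k)^n, so the integrated terms are 4^n
    times the geometric sequences of ratios 2^(a - 1) and 2^-a, both below 1 for 0 < a < 1. *)
Definition kapint (a : R) : R :=
  4 ^+ n * ((1 - 2 `^ (a - 1))^-1 + (1 - 2 `^ (- a))^-1).

Lemma integral_kap_le a x : (0 < n)%N -> 0 < a < 1 ->
  (\int[mu]_y (kap a (y - x))%:E <= (kapint a)%:E)%E.
Proof.
move=> n0 /andP[a0 a1].
have mt k : measurable_fun setT (term a x k).
  apply: emeasurable_funD; apply: measurable_funeM; apply/measurable_EFinP;
  exact: measurable_indic (measurable_cbox _ _).
apply: (@le_trans _ _ (\int[mu]_y \sum_(0 <= k <oo) term a x k y)%E).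
  apply: ge0_le_integral => //.
  - by move=> y _; rewrite lee_fin kap_ge0.
  - apply/measurable_EFinP; apply: (measurableT_comp (measurable_kap a)).
    exact: measurable_sub_rV.
  - by apply: ge0_emeasurable_sum.
  - by move=> y _; exact: kap_le_term.
rewrite integral_nneseries//.
pose A : \bar R := ((4 ^+ n)%:E * (\sum_(0 <= k <oo) ((2 `^ (a - 1)) ^+ k)%:E +
  \sum_(0 <= k <oo) ((2 `^ (- a)) ^+ k)%:E))%E.
apply: (@le_trans _ _ A); last first.
  rewrite /A /kapint EFinM; apply: lee_wpmul2l; first by rewrite lee_fin exprn_ge0.
  by rewrite EFinD leeD//; apply: geometric_nneseries; rewrite ?powR_gt0//; apply: powR2_lt1; lra.
rewrite /A -nneseriesD// -nneseriesZl//; last first.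
  by move=> k _; rewrite -EFinD lee_fin addr_ge0// exprn_ge0// powR_ge0.
apply: lee_nneseries => [k _ _|k _]; first exact: integral_ge0.
have mi (r : R) : measurable_fun setT (fun y => (\1_(cbox x r) y)%:E : \bar R).
  by apply/measurable_EFinP; exact: measurable_indic (measurable_cbox _ _).
rewrite /term ge0_integralD//; [|exact: measurable_funeM..].
rewrite !ge0_integralZl//.
have p0 : 0 < 2 ^+ k :> R by rewrite exprn_gt0.
rewrite !integral_indic ?setIT//; try exact: measurable_cbox.
have p0' := ltW p0; rewrite !lebesgue_cbox ?divr_ge0 ?mulr_ge0//.
rewrite -!EFinM -!EFinD lee_fin mulrDr.
have e (b : R) : (2 `^ (n%:R + b)) ^+ k = (2 `^ b) ^+ k * (2 ^+ k) ^+ n.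
  rewrite powRD; last by apply/implyP.
  by rewrite powR_mulrn// exprMn mulrC -!exprM mulnC.
have -> : 2 `^ (n%:R + a - 1) = 2 `^ (n%:R + (a - 1)) :> R by congr (_ `^ _); ring.
rewrite (e (a - 1)).
have -> : (2 `^ (- a)) ^+ k = (2 `^ (n%:R + (- (n%:R + a)))) ^+ k :> R.
  by congr (_ `^ _ ^+ _); ring.
rewrite (e (- (n%:R + a))).
have -> : 2 * (2 / 2 ^+ k) = 4 / 2 ^+ k :> R by rewrite mulrA; congr (_ / _); ring.
have -> : 2 * (2 * 2 ^+ k) = 4 * 2 ^+ k :> R by rewrite mulrA; congr (_ * _); ring.
rewrite !exprMn exprVn.
have X0 : (2 ^+ k) ^+ n != 0 :> R by rewrite expf_neq0// gt_eqF.
move: ((2 ^+ k) ^+ n) X0 => X X0; rewrite le_eqVlt; apply/predU1P; left.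
congr (_ + _); last by rewrite mulrCA.
by rewrite mulrACA mulfV// mulr1 mulrC.
Qed.

End KernelIntegral.

(** * Smooth bumps *)

Section FlatFunctions.
Context {R : realType}.
Implicit Types (p q : {poly R}) (m : nat) (t s : R).

Lemma is_derive_horner p t : is_derive t 1 (horner p) p^`().[t].
Proof.
apply: DeriveDef; first exact: derivable_horner.
by rewrite derivE derive1E.
Qed.

(* For a fixed q this class is closed under derivation, by is_derive_flat. *)
Definition flat q p m t : R :=
  if 0 < q.[t] then p.[t] * q.[t]^-1 ^+ m * expR (- q.[t]^-1) else 0.

(** Numerator of the derivative of p q^-m exp(-1/q) over the denominator q^(m + 2). *)
Definition flat_deriv q p m : {poly R} :=
  p^`() * q ^+ 2 - m%:R *: (p * q^`() * q) + p * q^`().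

(** Keeping only the term of index m + 2 in the exponential series at 1/s leaves a factor s^2: one
    power more than the vanishing of a difference quotient requires. *)
Lemma expVN_le m s : 0 < s -> s^-1 ^+ m * expR (- s^-1) <= m.+2`!%:R * s ^+ 2.
Proof.
move=> s0; rewrite expRN ler_pdivrMr ?expR_gt0//.
have f0 : 0 < m.+2`!%:R :> R by rewrite ltr0n fact_gt0.
have H : s^-1 ^+ m.+2 <= m.+2`!%:R * expR s^-1.
  rewrite -ler_pdivrMl//; apply: le_trans (expR_ge1Dxn m.+1 (ltW _)).
    by rewrite mulrC lerDr.
  by rewrite invr_gt0.
by rewrite mulrAC -ler_pdivrMr ?exprn_gt0// -exprVn -exprD addn2.
Qed.

Lemma is_derive_flat q p m t :
  is_derive t 1 (flat q p m) (flat q (flat_deriv q p m) m.+2 t).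
Proof.
have [qt|qt] := ltP 0 q.[t].
  have qn0 : q.[t] != 0 by rewrite gt_eqF.
  have q_near : \near t, 0 < q.[t].
    by have := @continuous_horner R q t; move/cvgr_gt; apply.
  pose f s := p.[s] * q.[s]^-1 ^+ m * expR (- q.[s]^-1).
  apply: (@near_eq_is_derive _ _ _ f).
    by near=> s; rewrite /flat ifT//; near: s.
  have dq := is_derive_horner q t; have dp := is_derive_horner p t.
  have dV := is_deriveV qn0 dq.
  have dE : is_derive t 1 (expR \o (fun s => - q.[s]^-1))
      (expR (- q.[t]^-1) * (q.[t] ^- 2 * q^`().[t])).
    apply: is_derive1_comp.
    by have := is_deriveN dV; rewrite scaleNr opprK.
  have dX := is_deriveX m dV; rewrite exprfctE in dX.
  have dM := is_deriveM (is_deriveM dp dX) dE.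
  move: dM; set D := (X in is_derive _ _ _ X) => dM.
  suff <- : D = flat q (flat_deriv q p m) m.+2 t by exact: dM.
  rewrite /D /flat qt.
  rewrite (exprS _ m.+1) (exprS _ m) /flat_deriv /GRing.scale/= !fctE !(hornerD, hornerN, hornerM, hornerZ, horner_exp).
  have -> : (m%:R * q.[t]^-1 ^+ m.-1) * (- q.[t] ^- 2 * q^`().[t]) =
    - m%:R * q.[t]^-1 ^+ m.+1 * q^`().[t].
    case: (m) => [|k] /=; first by rewrite !(mul0r,oppr0).
    by rewrite !exprS; field.
  rewrite !(exprS _ m).
  by move: (_ ^+ m) (expR _) => X Y; field.
(* Where q.[t] <= 0, flat is at most quadratic in q.[h + t] - q.[t]. *)
rewrite /flat ltNge qt /=.
suff H : (fun h => h^-1 *: ((flat q p m \o shift t) (h *: 1) - flat q p m t)) @ 0^'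
    --> (0 : R).
  by apply: DeriveDef; [apply/cvg_ex; exists 0|exact/cvg_lim].
have -> : flat q p m t = 0 by rewrite /flat ltNge qt.
pose Q (h : R) := q.[h + t] - q.[t].
(* Where the flat function is nonzero, q(t) <= 0 < q(h + t) gives q(h + t) <= |Q h|, and [expVN_le]
   yields two factors Q h. Divided by h, one of them tends to q'(t), while the other tends to 0. *)
pose b (h : R) := `|p.[h + t]| * m.+2`!%:R * `|Q h| * `|h^-1 * Q h|.
have sh : (fun h : R => h + t) @ 0^' --> t.
  have sh0 : (fun h : R => h + t) @ (0 : R) --> 0 + t.
    by apply: cvgD; [exact: cvg_id|exact: cvg_cst].
  by rewrite add0r in sh0; exact: cvg_within_filter sh0.
have cq : (fun h => q.[h + t]) @ 0^' --> q.[t].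
  apply: (cvg_comp _ _ sh); exact: continuous_horner.
have cp : (fun h => p.[h + t]) @ 0^' --> p.[t].
  apply: (cvg_comp _ _ sh); exact: continuous_horner.
have cQ : Q @ 0^' --> 0.
  by rewrite -[X in _ --> X](subrr q.[t]); apply: cvgB => //; exact: cvg_cst.
have cq' : (fun h => h^-1 * Q h) @ 0^' --> q^`().[t].
  have [dq <-] := is_derive_horner q t.
  rewrite (_ : (fun h => _) =
    (fun h => h^-1 *: ((horner q \o shift t) (h *: 1) - q.[t]))) //.
  by apply/funext => h; rewrite /Q /= /GRing.scale/= mulr1.
have cb : b @ 0^' --> 0.
  have c1 : (fun h => `|p.[h + t]| * m.+2`!%:R) @ 0^' --> `|p.[t]| * m.+2`!%:R.
    by apply: cvgMl; exact: cvg_norm cp.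
  have := cvgM (cvgM c1 (cvg_norm cQ)) (cvg_norm cq').
  by rewrite normr0 mulr0 mul0r; apply. 
apply/norm_cvg0P; apply: (squeeze_cvgr _ (cvg_cst 0) cb).
near=> h; rewrite normr_ge0 /= subr0 /GRing.scale/= mulr1 /flat.
case: ifPn => [qh|_]; last by rewrite mulr0 normr0 /b !mulr_ge0.
rewrite !normrM [`|expR _|]ger0_norm ?expR_ge0// normrX /b normrM.
have qQ : q.[h + t] <= `|Q h|.
  by rewrite /Q; apply: le_trans (ler_norm _); rewrite lerBrDr gerDl.
have := expVN_le m qh; rewrite -[X in X ^+ m]gtr0_norm ?invr_gt0// => H.
have {}H : `|q.[h + t]^-1| ^+ m * expR (- q.[h + t]^-1) <= m.+2`!%:R * `|Q h| ^+ 2.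
  apply: le_trans H _; rewrite ler_wpM2l// lerXn2r ?nnegrE//; exact: ltW.
rewrite [leRHS](_ : _ = `|h^-1| * (`|p.[h + t]| * (m.+2`!%:R * `|Q h| ^+ 2))); last by ring.
by rewrite ler_wpM2l// -mulrA ler_wpM2l.
Unshelve. all: by end_near. Qed.

End FlatFunctions.

Section FlatProducts.
Context {R : realType} {n : nat}.
Implicit Types (x y : 'rV[R]_n) (q p : 'I_n -> {poly R}) (m : 'I_n -> nat).

Lemma continuous_flat (q p : {poly R}) (m : nat) : continuous (flat q p m).
Proof.
move=> t; have [d _] := is_derive_flat q p m t.
by apply: differentiable_continuous; apply/derivable1_diffP.
Qed.

Definition flatprod q p m x : R := \prod_(i < n) flat (q i) (p i) (m i) (x ord0 i).

Lemma continuous_flatprod q p m : continuous (flatprod q p m).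
Proof.
apply: (@continuous_big R^o _ *%R 1 xpredT (@mul_continuous _) _ _ (fun i x => flat (q i) (p i) (m i) (x ord0 i))).
move=> i _ x.
by apply: continuous_comp; [exact: coord_continuous|exact: continuous_flat].
Qed.

Definition upd T (i : 'I_n) (a : T) (f : 'I_n -> T) j := if j == i then a else f j.

Lemma is_derive_flatprod q p m (i : 'I_n) x :
  is_derive x (delta_mx ord0 i) (flatprod q p m)
    (flatprod q (upd i (flat_deriv (q i) (p i) (m i)) p)
       (upd i (m i).+2 m) x).
Proof.
set C := \prod_(j < n | j != i) flat (q j) (p j) (m j) (x ord0 j).
have -> : flatprod q (upd i (flat_deriv (q i) (p i) (m i)) p)
       (upd i (m i).+2 m) x
  = flat (q i) (flat_deriv (q i) (p i) (m i)) (m i).+2 (x ord0 i) * C.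
  rewrite /flatprod (bigD1 i)//= /upd eqxx; congr (_ * _).
  by apply: eq_bigr => j ji; rewrite (negbTE ji).
have [d1 d2] := is_derive_flat (q i) (p i) (m i) (x ord0 i).
have H : (fun h : R => h^-1 *: ((flatprod q p m \o shift x) (h *: delta_mx ord0 i)
      - flatprod q p m x)) @ 0^' -->
    flat (q i) (flat_deriv (q i) (p i) (m i)) (m i).+2 (x ord0 i) * C.
  rewrite -d2 (_ : (fun h => _) = (fun h : R =>
    (h^-1 *: ((flat (q i) (p i) (m i) \o shift (x ord0 i)) (h *: 1)
      - flat (q i) (p i) (m i) (x ord0 i))) * C)); first exact: cvgMr_tmp.
  apply/funext => h; rewrite /flatprod /= /GRing.scale/= mulr1 -mulrA; congr (_ * _).
  rewrite (bigD1 i)//= [X in _ - X](bigD1 i)//= -/C !mxE !eqxx mulr1 mulrBl.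
  congr (_ * _ - _); apply: eq_bigr => j ji.
  by rewrite !mxE eqxx (negbTE ji) mulr0 add0r.
by apply: DeriveDef; [apply/cvg_ex; eexists; exact: H|exact/cvg_lim].
Qed.

(** A partial derivative changes a single factor, so for fixed [q] the class is stable under all
    iterated derivatives, and smoothness reduces to continuity and derivability of its members. *)
Lemma foldr_partial_flatprod q p m s : exists p' m',
  foldr partial (flatprod q p m) s = flatprod q p' m'.
Proof.
elim: s => [|i s [p' [m' /= ->]]]; first by exists p, m.
exists (upd i (flat_deriv (q i) (p' i) (m' i)) p'), (upd i (m' i).+2 m').
by apply/funext => x; case: (is_derive_flatprod q p' m' i x).
Qed.

Lemma smooth_flatprod q p m : smooth (flatprod q p m).
Proof.
move=> s /=; have [p' [m' ->]] := foldr_partial_flatprod q p m s.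
split; first exact: continuous_flatprod.
by move=> i x; have [] := is_derive_flatprod q p' m' i x.
Qed.

End FlatProducts.

Section Bump.
Context {R : realType} {n : nat}.
Implicit Types (a b x y : 'rV[R]_n).

(** The factor [k.+1] makes exp(-1/q) tend to 1 on the open interval as k grows, so that bumps
    approach indicators of boxes ([bump_cvg]). *)
Definition bump_poly (k : nat) (a b : R) : {poly R} :=
  k.+1%:R *: (('X - a%:P) * (b%:P - 'X)).

Lemma bump_polyE k (a b t : R) :
  (bump_poly k a b).[t] = k.+1%:R * ((t - a) * (b - t)).
Proof. by rewrite /bump_poly !hornerE. Qed.

Lemma bump_poly_gt0 k (a b t : R) : a < b ->
  (0 < (bump_poly k a b).[t]) = (a < t < b).
Proof.
move=> ab; rewrite bump_polyE pmulr_rgt0 ?ltr0n//.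
apply/idP/idP => [H|/andP[? ?]]; last by rewrite mulr_gt0 ?subr_gt0.
by apply/andP; split; rewrite ltNge; apply/negP => ?; nra.
Qed.

Definition bump1 (k : nat) (a b : R) : R -> R := flat (bump_poly k a b) 1 0.

Lemma bump1_itv k (a b t : R) : 0 <= bump1 k a b t <= 1.
Proof.
rewrite /bump1 /flat; case: ifPn => [q0|_]; last by rewrite lexx ler01.
rewrite expr0 -(polyC1 R) hornerC !mul1r expR_ge0 -[leRHS]expR0 ler_expR oppr_le0 invr_ge0.
exact: ltW.
Qed.

Lemma bump1_out k (a b t : R) : a < b -> ~~ (a < t < b) -> bump1 k a b t = 0.
Proof. by move=> ab; rewrite -(bump_poly_gt0 k)// /bump1 /flat => /negbTE ->. Qed.

(** The derivative is continuous and vanishes off the interval, hence is bounded by its maximum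
    there; the mean value theorem concludes. *)
Lemma bump1_lipschitz k (a b : R) : a < b -> exists2 L : R, 0 <= L &
  forall s t, `|bump1 k a b s - bump1 k a b t| <= L * `|s - t|.
Proof.
move=> ab; set q := bump_poly k a b.
pose g := flat q (flat_deriv q 1 0) 2.
have cg : continuous (fun t => `|g t|).
  by move=> t; apply: cvg_norm; exact: continuous_flat.
have [c _ gc] := EVT_max (ltW ab) (continuous_subspaceT cg).
exists `|g c| => [//|].
have gle t : `|g t| <= `|g c|.
  have [qt|qt] := ltP 0 q.[t]; last by rewrite /g /flat ltNge qt normr0.
  by apply: gc; rewrite in_itv/=; move: qt; rewrite bump_poly_gt0// => /andP[/ltW-> /ltW->].
suff H s t : s <= t -> `|bump1 k a b t - bump1 k a b s| <= `|g c| * `|t - s|.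
  move=> s t; have [|/ltW] := leP s t; last exact: H.
  by move=> /H; rewrite distrC [in leRHS]distrC.
move=> st; have [||z _ ->] := MVT_segment st (f := bump1 k a b) (df := g).
- by move=> x _; exact: is_derive_flat.
- by apply: continuous_subspaceT; exact: continuous_flat.
by rewrite normrM ler_wpM2r.
Qed.

(** Factors are replaced one at a time, the others having absolute value at most 1. *)
Lemma norm_prodB_le (I : Type) (s : seq I) (f g : I -> R) :
  (forall i, 0 <= f i <= 1) -> (forall i, 0 <= g i <= 1) ->
  `|\prod_(i <- s) f i - \prod_(i <- s) g i| <= \sum_(i <- s) `|f i - g i|.
Proof.
move=> f01 g01; elim: s => [|i s IH]; first by rewrite !big_nil subrr normr0.
rewrite !big_cons.
set F := \prod_(j <- s) f j; set G := \prod_(j <- s) g j.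
rewrite (_ : _ - _ = (f i - g i) * F + g i * (F - G)); last by ring.
apply: le_trans (ler_normD _ _) _; rewrite !normrM; apply: lerD.
  rewrite ler_piMr// ger0_norm; last first.
    by apply: prodr_ge0 => j _; have /andP[] := f01 j.
  by apply: prodr_ile1 => j _.
have /andP[g0 g1] := g01 i.
by rewrite ger0_norm//; apply: le_trans IH; rewrite ler_piMl.
Qed.

Definition rbump k a b x : R := \prod_(i < n) bump1 k (a ord0 i) (b ord0 i) (x ord0 i).

Definition obox a b : set 'rV[R]_n := [set x | forall i, a ord0 i < x ord0 i < b ord0 i].

Lemma bump_itv k a b x : 0 <= rbump k a b x <= 1.
Proof.
apply/andP; split.
  by apply: prodr_ge0 => i _; have /andP[] := bump1_itv k (a ord0 i) (b ord0 i) (x ord0 i).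
by apply: prodr_ile1 => i _; exact: bump1_itv.
Qed.

Lemma bump_out k a b x : (forall i, a ord0 i < b ord0 i) -> ~ obox a b x -> rbump k a b x = 0.
Proof.
move=> ab /existsNP[i /negP xi]; rewrite /rbump (bigD1 i)//= bump1_out ?mul0r//.
Qed.

Lemma bump_lipschitz k a b : (forall i, a ord0 i < b ord0 i) -> exists2 L : R, 0 <= L &
  forall x y, `|rbump k a b x - rbump k a b y| <= L * `|x - y|.
Proof.
move=> ab.
have /choice[L HL] : forall i, exists L : R, 0 <= L /\
    forall s t, `|bump1 k (a ord0 i) (b ord0 i) s - bump1 k (a ord0 i) (b ord0 i) t| <= L * `|s - t|.
  by move=> i; have [L ? ?] := bump1_lipschitz k (ab i); exists L.
exists (\sum_i L i); first by apply: sumr_ge0 => i _; have [] := HL i.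
move=> x y; apply: le_trans (norm_prodB_le _ _ _) _.
- by move=> i; exact: bump1_itv.
- by move=> i; exact: bump1_itv.
rewrite mulr_suml; apply: ler_sum => i _; have [L0 H] := HL i.
apply: le_trans (H _ _) _; rewrite ler_wpM2l//.
by have := ler_coord_norm (x - y) i; rewrite !mxE.
Qed.

Lemma test_function_bump k a b : (forall i, a ord0 i < b ord0 i) ->
  test_function (rbump k a b).
Proof.
move=> ab; split; first exact: smooth_flatprod.
have cb : compact [set v : 'rV[R]_n | forall i, v ord0 i \in `[a ord0 i, b ord0 i]].
  apply: (@rV_compact _ _ (fun i => `[a ord0 i, b ord0 i]%classic)) => i.
  exact: segment_compact.
apply: (subclosed_compact (@closed_closure _ _) cb).
rewrite [X in _ `<=` X](closure_id _).1; last first.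
  exact: compact_closed cb.
apply: closure_subset => x /= bx i.
have [] := pselect (obox a b x); last by move=> /(bump_out k ab) b0; rewrite b0 eqxx in bx.
by move=> /(_ i)/andP[/ltW ? /ltW ?]; rewrite in_itv/=; apply/andP.
Qed.

Lemma measurable_bump k a b : measurable_fun setT (rbump k a b).
Proof. by apply: continuous_measurable_rV; exact: continuous_flatprod. Qed.

Lemma bump_cvg a b x : (forall i, a ord0 i < b ord0 i) ->
  (fun k => rbump k a b x) @ \oo --> (\1_(obox a b) x : R).
Proof.
move=> ab; rewrite indicE; case: (pselect (obox a b x)) => [xab|xab]; last first.
  rewrite memNset// (_ : (fun k => _) = cst 0); first exact: cvg_cst.
  by apply/funext => k; exact: bump_out.
rewrite mem_set//= (_ : 1 = \prod_(i < n) (1 : R)); last by rewrite big1.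
apply: (@cvg_big R^o _ *%R 1 xpredT (@mul_continuous _)) => i _.
have c0 : 0 < (x ord0 i - a ord0 i) * (b ord0 i - x ord0 i).
  by have /andP[? ?] := xab i; rewrite mulr_gt0 ?subr_gt0.
rewrite (_ : (fun k => _) = (fun k : nat => expR (- (k.+1%:R^-1 *
    ((x ord0 i - a ord0 i) * (b ord0 i - x ord0 i))^-1)))); last first.
  apply/funext => k; rewrite /bump1 /flat bump_poly_gt0// xab.
  by rewrite expr0 -(polyC1 R) hornerC !mul1r bump_polyE invfM.
rewrite -[X in _ --> X]expR0.
move: (_ * _)^-1 => C.
have H : (fun k : nat => - (k.+1%:R^-1 * C)) @ \oo --> (0 : R).
  rewrite -[X in _ --> X]oppr0 -(mul0r C); apply: cvgN.
  by apply: cvgMr_tmp; exact: cvg_harmonic.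
exact: (cvg_comp _ _ H (@continuous_expR R 0)).
Qed.

End Bump.

(** * The fractional gradient of a bump *)

Section RieszKernel.
Context {R : realType} {n : nat}.
Implicit Types (x y z : 'rV[R]_n) (a : R) (i : 'I_n).
Local Notation mu := (@lebesgue_rV R n).

(** Coordinate i of the kernel z / |z|^(n + a + 1). Inverses are written as real powers, so that
    measurability comes from [measurable_powR]. *)
Definition rker a i z : R :=
  z ord0 i * enorm z `^ (-1) * enorm z `^ (- (n%:R + a)).

Lemma rker0 a i : rker a i 0 = 0.
Proof. by rewrite /rker mxE !mul0r. Qed.

Lemma measurable_rker a i : measurable_fun setT (rker a i).
Proof.
apply: measurable_funM; [apply: measurable_funM|].
- exact: measurable_coord.
- exact: (measurableT_comp (measurable_powR _) measurable_enorm).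
- exact: (measurableT_comp (measurable_powR _) measurable_enorm).
Qed.

Lemma ler_coord_enorm z i : `|z ord0 i| <= enorm z.
Proof. exact: le_trans (ler_coord_norm z i) (norm_le_enorm z). Qed.

Lemma powRN_le (s t r : R) : 0 < s -> s <= t -> 0 <= r -> t `^ (- r) <= s `^ (- r).
Proof.
move=> s0 st r0; have t0 := lt_le_trans s0 st.
rewrite !powRN lef_pV2 ?posrE ?powR_gt0//.
by apply: ge0_ler_powR; rewrite ?nnegrE// ltW.
Qed.

Lemma rker_le a i z : 0 < a -> `|rker a i z| <= `|z| `^ (- (n%:R + a)).
Proof.
move=> a0; have [->|z0] := eqVneq z 0; first by rewrite rker0 normr0 powR_ge0.
have nz : 0 < `|z| by rewrite normr_gt0.
have ez : 0 < enorm z := lt_le_trans nz (norm_le_enorm z).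
have na : 0 <= n%:R + a by rewrite addr_ge0// ltW.
rewrite /rker normrM normrM ![`|_ `^ _|]ger0_norm ?powR_ge0//.
rewrite powR_inv1 ?(ltW ez)// -[leRHS]mul1r.
apply: ler_pM; rewrite ?mulr_ge0 ?powR_ge0 ?invr_ge0 ?(ltW ez)//.
  by rewrite ler_pdivrMr// mul1r ler_coord_enorm.
exact: powRN_le (norm_le_enorm z) na.
Qed.

Lemma riesz_gradE a phi x i : riesz_grad a phi x ord0 i =
  @riesz_cst R n a * \int[mu]_y ((phi y - phi x) * rker a i (y - x)).
Proof.
rewrite mxE; congr (_ * _); apply: eq_Rintegral => y _.
rewrite /rker powR_inv1 ?enorm_ge0// powRN; ring.
Qed.

Lemma kapN a z : kap a (- z) = kap a z.
Proof. by rewrite /kap normrN. Qed.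

Section Integrand.
Variables (a : R) (i : 'I_n) (phi : 'rV[R]_n -> R) (B : set 'rV[R]_n) (L : R).
Hypotheses (n0 : (0 < n)%N) (a01 : 0 < a < 1).
Hypotheses (mphi : measurable_fun setT phi) (phi01 : forall x, 0 <= phi x <= 1).
Hypotheses (mB : measurable B) (Bfin : (mu B < +oo)%E).
Hypothesis phiB : forall x, ~ B x -> phi x = 0.
Hypotheses (L0 : 0 <= L) (phiL : forall x y, `|phi x - phi y| <= L * `|x - y|).

Definition rintegrand (xy : 'rV[R]_n * 'rV[R]_n) : R :=
  (phi xy.2 - phi xy.1) * rker a i (xy.2 - xy.1).

(** The increment of [phi] is at most min(1, L |y - x|), and it vanishes when both points lie off B.
    Each summand on the right is integrable on the product space: [kap] is integrable in one
    variable uniformly in the other, and B has finite measure. *)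
Lemma rintegrand_le x y : `|rintegrand (x, y)| <=
  (1 + L) * (kap a (y - x) * \1_B x) + (1 + L) * (kap a (y - x) * \1_B y).
Proof.
have /andP[a0 a1] := a01; rewrite /rintegrand /= normrM.
have k0 := kap_ge0 a (y - x).
have i0 z : 0 <= \1_B z :> R by rewrite indicE.
have rhs0 : 0 <= (1 + L) * (kap a (y - x) * \1_B x) +
  (1 + L) * (kap a (y - x) * \1_B y) by rewrite addr_ge0// !mulr_ge0// addr_ge0.
have main : `|phi y - phi x| * `|rker a i (y - x)| <= (1 + L) * kap a (y - x).
  apply: le_trans (ler_wpM2l (normr_ge0 _) (rker_le i (y - x) a0)) _.
  rewrite /kap mulrA ler_wpM2r ?powR_ge0//.
  have /andP[px0 px1] := phi01 x; have /andP[py0 py1] := phi01 y.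
  have d1 : `|phi y - phi x| <= 1 by rewrite ler_norml; apply/andP; split; lra.
  rewrite minEle; case: ifPn => _.
    by rewrite mulr1; apply: le_trans d1 _; rewrite lerDl.
  by apply: le_trans (phiL _ _) _; rewrite ler_wpM2r// lerDr.
case: (pselect (B x)) => Bx.
  rewrite [\1_B x]indicE mem_set// mulr1; apply: le_trans main _.
  by rewrite lerDl !mulr_ge0// addr_ge0.
case: (pselect (B y)) => By.
  rewrite [\1_B y]indicE mem_set// mulr1; apply: le_trans main _.
  by rewrite lerDr !mulr_ge0// addr_ge0.
by rewrite !phiB// subrr normr0 mul0r.
Qed.

Lemma measurable_sub21 : measurable_fun setT
  (fun xy : 'rV[R]_n * 'rV[R]_n => xy.2 - xy.1).
Proof. by apply: measurable_sub_rV; [exact: measurable_snd|exact: measurable_fst]. Qed.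

Lemma measurable_rintegrand : measurable_fun setT rintegrand.
Proof.
apply: measurable_funM.
  by apply: measurable_funB; [exact: (measurableT_comp mphi measurable_snd)|
    exact: (measurableT_comp mphi measurable_fst)].
exact: (measurableT_comp (measurable_rker a i) measurable_sub21).
Qed.

Let k1 (xy : 'rV[R]_n * 'rV[R]_n) : \bar R := (kap a (xy.2 - xy.1) * \1_B xy.1)%:E.
Let k2 (xy : 'rV[R]_n * 'rV[R]_n) : \bar R := (kap a (xy.2 - xy.1) * \1_B xy.2)%:E.

Let mk1 : measurable_fun setT k1.
Proof.
apply/measurable_EFinP; apply: measurable_funM.
  exact: (measurableT_comp (measurable_kap a) measurable_sub21).
exact: (measurableT_comp (measurable_indic mB) measurable_fst).
Qed.

Let mk2 : measurable_fun setT k2.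
Proof.
apply/measurable_EFinP; apply: measurable_funM.
  exact: (measurableT_comp (measurable_kap a) measurable_sub21).
exact: (measurableT_comp (measurable_indic mB) measurable_snd).
Qed.

Let int_indic : (\int[mu]_x ((@kapint R n a)%:E * (\1_B x)%:E) < +oo)%E.
Proof.
have mI : measurable_fun setT (fun x : 'rV[R]_n => (\1_B x)%:E : \bar R).
  by apply/measurable_EFinP; exact: measurable_indic.
have K0 : (0 <= (@kapint R n a)%:E)%E.
  apply: le_trans (integral_kap_le (0 : 'rV[R]_n) n0 a01).
  by apply: integral_ge0 => y _; rewrite lee_fin kap_ge0.
rewrite ge0_integralZl//.
rewrite integral_indic// setIT.
by rewrite lte_mul_pinfty.
Qed.

Let integrable_k1 : (mu \x mu)%E.-integrable setT k1.
Proof.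
apply/integrable12ltyP => //; apply: le_lt_trans int_indic.
apply: ge0_le_integral => //.
- by move=> x _; apply: integral_ge0.
- apply: (measurable_fun_fubini_tonelli_F (abse \o k1)) => //=.
  exact: measurableT_comp.
- by apply: measurable_funeM; apply/measurable_EFinP; exact: measurable_indic.
move=> x _; rewrite /k1 /=.
under eq_integral => y _ do rewrite ger0_norm ?mulr_ge0 ?kap_ge0// mulrC EFinM.
rewrite ge0_integralZl ?lee_fin//; last 2 first.
- apply/measurable_EFinP; apply: (measurableT_comp (measurable_kap a)).
  exact: measurable_sub_rV.
- by move=> y _; rewrite lee_fin kap_ge0.
by rewrite muleC lee_wpmul2r ?lee_fin// integral_kap_le.
Qed.

(** The indicator now constrains y, so the inner integral is taken in x, and evenness of [kap]
    brings back the bound centred at the fixed point. *)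
Let integrable_k2 : (mu \x mu)%E.-integrable setT k2.
Proof.
apply/integrable21ltyP => //; apply: le_lt_trans int_indic.
apply: ge0_le_integral => //.
- by move=> x _; apply: integral_ge0.
- apply: (measurable_fun_fubini_tonelli_G (abse \o k2)) => //=.
  exact: measurableT_comp.
- by apply: measurable_funeM; apply/measurable_EFinP; exact: measurable_indic.
move=> y _; rewrite /k2 /=.
under eq_integral => x _.
  rewrite ger0_norm ?mulr_ge0 ?kap_ge0// -kapN opprB mulrC EFinM; over.
rewrite ge0_integralZl ?lee_fin//; last 2 first.
- apply/measurable_EFinP; apply: (measurableT_comp (measurable_kap a)).
  exact: measurable_sub_rV.
- by move=> x _; rewrite lee_fin kap_ge0.
by rewrite muleC lee_wpmul2r ?lee_fin// integral_kap_le.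
Qed.

Lemma integrable_rintegrand : (mu \x mu)%E.-integrable setT (EFin \o rintegrand).
Proof.
have I := integrableD measurableT (integrableZl measurableT (1 + L) integrable_k1)
  (integrableZl measurableT (1 + L) integrable_k2).
apply: (le_integrable measurableT _ _ I).
  by apply/measurable_EFinP; exact: measurable_rintegrand.
move=> [x y] _; rewrite /= lee_fin; apply: le_trans (rintegrand_le x y) _.
exact: ler_norm.
Qed.

End Integrand.
End RieszKernel.

Section RieszBump.
Context {R : realType} {n : nat}.
Implicit Types (x y z : 'rV[R]_n) (i : 'I_n).
Local Notation mu := (@lebesgue_rV R n).
Local Notation mmu := (@lebesgue_rV R n : {measure set 'rV[R]_n -> \bar R}).

Lemma measurable_obox (a b : 'rV[R]_n) : measurable (obox a b).
Proof.
rewrite (_ : obox a b = \bigcap_(i in [set: 'I_n])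
    ((fun x : 'rV[R]_n => x ord0 i) @^-1` `]a ord0 i, b ord0 i[)); last first.
  apply/seteqP; split => x /= H i; first by move=> _ /=; rewrite in_itv/= H.
  by have /= := H i I; rewrite in_itv.
apply: fin_bigcap_measurable => // i _.
by rewrite -[X in measurable X]setTI; apply: measurable_coord => //; exact: measurable_itv.
Qed.

Lemma lebesgue_obox_lty (a b : 'rV[R]_n) : (forall i, a ord0 i < b ord0 i) ->
  (mmu (obox a b) < +oo)%E.
Proof.
move=> ab.
rewrite (_ : obox a b = [set y | forall i,
    [set` `]a ord0 i, b ord0 i[] (y ord0 i)]); last first.
  by apply/seteqP; split => y /= H i; have := H i; rewrite /= in_itv.
rewrite [ltLHS](@lebesgue_rV_box R n (fun i => [set` `]a ord0 i, b ord0 i[])); last first.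
  by move=> i; exact: measurable_itv.
rewrite (_ : (\prod_(i < n) _)%E = (\prod_(i < n) (b ord0 i - a ord0 i)%:E)%E).
  by rewrite prodEFin ltry.
by apply: eq_bigr => i _; rewrite lebesgue_measure_itv/= lte_fin ab.
Qed.

Variables (alpha : R) (i : 'I_n) (a b : 'rV[R]_n) (k : nat).
Hypotheses (a01 : 0 < alpha < 1) (ab : forall i, a ord0 i < b ord0 i).
Let n0 : (0 < n)%N. Proof. by case: (n) i => [[]|]. Qed.
Let phi := rbump k a b.

Let I0 : (mu \x mu)%E.-integrable setT (EFin \o rintegrand alpha i phi).
Proof.
have [L L0 phiL] := bump_lipschitz k ab.
apply: (integrable_rintegrand i n0 a01 (measurable_bump k a b) (bump_itv k a b)
  (measurable_obox a b) (lebesgue_obox_lty ab) _ L0 phiL).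
by move=> x; exact: bump_out.
Qed.

Let J x : \bar R := (\int[mu]_y (rintegrand alpha i phi (x, y))%:E)%E.

Let J_bound : exists2 M : R, 0 <= M & forall x, (`|J x| <= M%:E)%E.
Proof.
have [L L0 phiL] := bump_lipschitz k ab.
have K0 : (0 <= (@kapint R n alpha)%:E)%E.
  apply: le_trans (integral_kap_le (0 : 'rV[R]_n) n0 a01).
  by apply: integral_ge0 => y _; rewrite lee_fin kap_ge0.
exists (2 * (1 + L) * @kapint R n alpha).
  have Kr : 0 <= @kapint R n alpha by rewrite -lee_fin.
  by rewrite mulr_ge0// mulr_ge0// addr_ge0.
move=> x; have mf : measurable_fun setT (fun y => (rintegrand alpha i phi (x, y))%:E).
  apply/measurable_EFinP; apply: (measurableT_comp (measurable_rintegrand alpha i (measurable_bump k a b))).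
  by apply: measurable_fun_pair.
apply: le_trans (le_abse_integral _ measurableT mf) _.
apply: (@le_trans _ _ (\int[mu]_y ((2 * (1 + L))%:E * (kap alpha (y - x))%:E))%E).
  have c0 : 0 <= 2 * (1 + L) by rewrite mulr_ge0// addr_ge0.
  apply: ge0_le_integral => //.
  - exact: measurableT_comp.
  - apply: measurable_funeM; apply/measurable_EFinP.
    by apply: (measurableT_comp (measurable_kap _)); exact: measurable_sub_rV.
  move=> y _; rewrite -EFinM lee_fin.
  have := rintegrand_le i a01 (bump_itv k a b) (fun x => @bump_out _ _ k a b x ab) L0 phiL x y.
  move/le_trans; apply.
  have i1 z : \1_(obox a b) z <= 1 :> R by rewrite indicE; case: (_ \in _).
  set K := kap _ _; have K1 : 0 <= K by exact: kap_ge0.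
  rewrite [leRHS](_ : _ = (1 + L) * (K * 1) + (1 + L) * (K * 1)); last by ring.
  by apply: lerD; rewrite ler_wpM2l ?addr_ge0// ler_wpM2l.
rewrite ge0_integralZl//; last 3 first.
- apply/measurable_EFinP.
  by apply: (measurableT_comp (measurable_kap _)); exact: measurable_sub_rV.
- by move=> y _; rewrite lee_fin kap_ge0.
- by rewrite lee_fin mulr_ge0// addr_ge0.
by rewrite [leRHS]EFinM lee_wpmul2l ?integral_kap_le// lee_fin mulr_ge0// addr_ge0.
Qed.

Let JE x : (riesz_grad alpha phi x ord0 i)%:E = ((@riesz_cst R n alpha)%:E * J x)%E.
Proof.
rewrite riesz_gradE EFinM; congr (_ * _)%E; rewrite /Rintegral fineK//.
have [M _ HM] := J_bound.
by rewrite -abse_fin_num ge0_fin_numE//; exact: le_lt_trans (HM x) (ltry _).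
Qed.

Lemma integrable_riesz_bump :
  mu.-integrable setT (fun x => (riesz_grad alpha (rbump k a b) x ord0 i)%:E).
Proof.
under eq_fun do rewrite JE.
apply: (integrableZl measurableT); exact: (integrable_fubini_F I0).
Qed.

Lemma bounded_riesz_bump :
  exists2 M : R, 0 <= M & forall x, `|riesz_grad alpha (rbump k a b) x ord0 i| <= M.
Proof.
have [M M0 HM] := J_bound.
exists (`|@riesz_cst R n alpha| * M) => [|x]; first exact: mulr_ge0.
rewrite -lee_fin -abse_EFin JE abseM [leRHS]EFinM.
by apply: lee_wpmul2l; [rewrite lee_fin|exact: HM].
Qed.

(** With G the Riesz gradient, integrable and bounded by M, the inequality |u| <= 1 + |u|^p gives |u
    G| <= |G| + M |u|^p. *)
Lemma integrable_Lp_riesz_bump (p : R) u : 1 <= p -> Lp p%:E u ->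
  mu.-integrable setT (fun x => (u x * riesz_grad alpha (rbump k a b) x ord0 i)%:E).
Proof.
move=> p1 up; have [M M0 HM] := bounded_riesz_bump.
have Iup : mu.-integrable setT (fun x => (`|u x| `^ p)%:E) by exact: Lfun_integrable.
have I1 := integrableD measurableT (integrable_abse integrable_riesz_bump)
  (integrableZl measurableT M Iup).
apply: (le_integrable measurableT _ _ I1).
  apply/measurable_EFinP; apply: measurable_funM.
    by move: up; rewrite /Lp/= => /sub_Lfun_mfun; rewrite inE.
  by have /measurable_int/measurable_EFinP := integrable_riesz_bump.
move=> x _; rewrite /= lee_fin [leRHS]ger0_norm; last by rewrite addr_ge0 ?mulr_ge0 ?powR_ge0.
rewrite normrM; have [u1|/ltW u1] := leP `|u x| 1.
  apply: (@le_trans _ _ `|riesz_grad alpha (rbump k a b) x ord0 i|); first by rewrite ler_piMl.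
  by rewrite lerDl mulr_ge0 ?powR_ge0.
apply: (@le_trans _ _ (M * `|u x| `^ p)); last by rewrite lerDr.
rewrite mulrC ler_pM//; exact: le1r_powR.
Qed.

End RieszBump.

(** * The fundamental lemma of the calculus of variations *)

Section Fundamental.
Context {R : realType} {n : nat}.
Implicit Types (a b x y : 'rV[R]_n).
Local Notation mu := (@lebesgue_rV R n).

Let G : set (set 'rV[R]_n) := [set E | exists a b, E = obox a b].

Lemma obox_setI a b a' b' : obox a b `&` obox a' b' =
  obox (\row_i Num.max (a ord0 i) (a' ord0 i)) (\row_i Num.min (b ord0 i) (b' ord0 i)).
Proof.
apply/seteqP; split => [x [/= H1 H2] i|x /= H]; last first.
  by split => i; have := H i; rewrite !mxE gt_max lt_min => /andP[/andP[? ?] /andP[? ?]]; apply/andP.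
rewrite !mxE gt_max lt_min.
by have /andP[-> ->] := H1 i; have /andP[-> ->] := H2 i.
Qed.

Let GI : setI_closed G.
Proof. by move=> _ _ [a [b ->]] [a' [b' ->]]; rewrite obox_setI; eexists; eexists. Qed.

Lemma measurable_g_obox : (measurable : set (set 'rV[R]_n)) = <<s G >>.
Proof.
apply/seteqP; split; last first.
  apply: smallest_sub; first exact: sigma_algebra_measurable.
  by move=> _ [a [b ->]]; exact: measurable_obox.
have mc (i : 'I_n) : measurable_fun setT
    (fun x : g_sigma_algebraType G => (x : 'rV[R]_n) ord0 i : R).
  apply: (measurability _ (RGenOpens.measurableE R)).
  move=> _ [_ [c [d ->] <-]]; rewrite setTI.
  (* The cylinder over []c, d[] in direction i is the increasing union of the boxes whose other
     sides are ]-N, N[. *)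
  pose A N : 'rV[R]_n := \row_j (if j == i then c else - N%:R).
  pose C N : 'rV[R]_n := \row_j (if j == i then d else N%:R).
  rewrite (_ : _ @^-1` _ = \bigcup_N (obox (A N) (C N) : set (g_sigma_algebraType G))).
    apply: bigcup_measurable => N _; apply: sub_sigma_algebra.
    by exists (A N), (C N).
  apply/seteqP; split => [x /=|x [N _ /(_ i)]]; last first.
    by rewrite !mxE eqxx /= in_itv.
  rewrite in_itv/= => xcd; exists (Num.bound `|x : 'rV[R]_n|) => // j.
  rewrite !mxE; case: eqP => [->//|_].
  rewrite -ltr_norml; apply: le_lt_trans (ler_coord_norm _ _) _.
  exact: archi_boundP.
apply: smallest_sub; first exact: smallest_sigma_algebra.
case: (n) G mc => [|m] G' mc; first by rewrite big_ord0.
rewrite -bigcup_mkord_ord; apply: bigcup_sub => i Ii.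
by move=> _ [Y mY <-]; exact: mc.
Qed.

Section Vanish.
Variables (A C : 'rV[R]_n) (h : 'rV[R]_n -> R).
Hypothesis Ih : mu.-integrable setT (EFin \o h).
Hypothesis h0 : forall a b k, (forall i, a ord0 i < b ord0 i) ->
  obox a b `<=` obox A C -> \int[mu]_x (h x * rbump k a b x) = 0.

Let mh : measurable_fun setT h.
Proof. by have /measurable_int/measurable_EFinP := Ih. Qed.

Let Ihb a b k : mu.-integrable setT (EFin \o (fun x => h x * rbump k a b x)).
Proof.
apply: (le_integrable measurableT _ _ Ih).
  by apply/measurable_EFinP; apply: measurable_funM => //; exact: measurable_bump.
move=> x _; rewrite /= lee_fin normrM ler_piMr//.
by have /andP[? ?] := bump_itv k a b x; rewrite ger0_norm.
Qed.

Let box0 a b : obox a b `<=` obox A C -> (\int[mu]_(x in obox a b) (h x)%:E = 0)%E.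
Proof.
move=> sub; case: (pselect (forall i, a ord0 i < b ord0 i)) => [ab|nab]; last first.
  rewrite (_ : obox a b = set0) ?integral_set0//.
  apply/seteqP; split => // x /= H; apply: nab => i.
  by have /andP[] := H i; exact: lt_trans.
have mi : measurable_fun setT (fun x => (h x * \1_(obox a b) x)%:E : \bar R).
  apply/measurable_EFinP; apply: measurable_funM => //.
  by apply: measurable_indic; exact: measurable_obox.
have [] := @dominated_convergence _ _ _ mu setT measurableT
  (fun k x => (h x * rbump k a b x)%:E) (fun x => (h x * \1_(obox a b) x)%:E)
  (fun x => `|(h x)%:E|%E) _ mi _ _ _.
- by move=> k; exact: measurable_int (Ihb a b k).
- apply: aeW => x _; apply: cvg_EFin; first exact: nearW.
  by apply: cvgMl_tmp; exact: bump_cvg.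
- exact: integrable_abse.
- apply: aeW => x k _; rewrite /= lee_fin normrM ler_piMr//.
  by have /andP[? ?] := bump_itv k a b x; rewrite ger0_norm.
move=> _ _ cv; rewrite integral_mkcond.
have -> : (EFin \o h) \_ (obox a b) = (fun x => (h x * \1_(obox a b) x)%:E).
  apply/funext => x; rewrite patchE indicE; case: ifP => _; by rewrite ?mulr1 ?mulr0.
apply: (cvg_unique _ cv) => //.
suff -> : [sequence (\int[mu]_x (h x * rbump k a b x)%:E)%E]_k = cst 0%E :> (nat -> \bar R).
  exact: cvg_cst.
apply/funext => k /=; have := h0 k ab sub; rewrite /Rintegral => e.
rewrite -[LHS]fineK ?e//; exact: integrable_fin_num (Ihb a b k).
Qed.

(** Letting k tend to infinity replaces bumps by indicators of boxes, by dominated convergence. Open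
    boxes are stable under intersection and generate the sigma-algebra, so Dynkin induction carries
    the vanishing of the integrals of [h], cut off to the large box, to all measurable sets. *)
Lemma ae0_of_rbump : {ae mu, forall x, obox A C x -> h x = 0}.
Proof.
have mB := measurable_obox A C.
have IB : mu.-integrable (obox A C) (EFin \o h) by apply: integrableS Ih.
pose g := (EFin \o h) \_ (obox A C).
have Ig : mu.-integrable setT g by exact: (integrable_mkcond _ mB).1.
have gE E : measurable E ->
    (\int[mu]_(x in E) g x = \int[mu]_(x in E `&` obox A C) (h x)%:E)%E.
  by move=> mE; rewrite -integral_mkcondr.
(* The complement step of the induction needs the integral over the whole space, which is the one
   over the box [obox A C] itself. *)
have g0T : (\int[mu]_(x in setT) g x = 0)%E.
  by rewrite gE// setTI; exact: box0.
have IgE E : measurable E -> mu.-integrable E g.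
  by move=> mE; exact: integrableS Ig.
have g0 E : measurable E -> (\int[mu]_(x in E) g x = 0)%E.
  rewrite measurable_g_obox.
  apply: (dynkin_induction (P := [set E | \int[mu]_(x in E) g x = 0]%E)
     measurable_g_obox GI) => //=.
  - move=> _ [a [b ->]] /=; rewrite gE; last exact: measurable_obox.
    by rewrite obox_setI box0// -obox_setI.
  - move=> S mS S0.
    have := @integral_setU _ _ _ mu S (~` S) g mS (measurableC mS).
    rewrite setUv g0T S0 add0e => ->//.
    - exact: measurable_int Ig.
    - by apply/disj_setPCl.
  - move=> F mF tF F0; rewrite integral_bigcup//; last exact/IgE/bigcup_measurable.
    by rewrite eseries0.
have := @integral_ae_eq _ _ _ mu setT measurableT (cst 0%E) g Ig (measurable_cst _).
move=> /(_ (fun E _ mE => etrans (g0 E mE) (esym (integral0 _ _)))).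
apply: filterS => x /= /(_ I); rewrite /g patchE => + xB.
by rewrite mem_set//= => -[].
Qed.

End Vanish.
End Fundamental.

(** * Uniform boundedness and weak convergence *)

Section GlidingHump.
Context d (T : measurableType d) {R : realType} (mu : {measure set T -> \bar R}).
Variables (D : set T) (mD : measurable D) (w : nat -> T -> R).
Hypothesis Iw : forall j, mu.-integrable D (EFin \o w j).

Let pairing j (k : T -> R) : R := \int[mu]_(x in D) (w j x * k x).

Let good (M : R) (k : T -> R) := measurable_fun setT k /\ forall x, `|k x| <= M.

Let integrable_pairing j M k : good M k -> mu.-integrable D (EFin \o (fun x => w j x * k x)).
Proof.
move=> [mk kM]; have M0 : D !=set0 -> 0 <= M.
  by move=> [x _]; apply: le_trans (kM x).
have I1 := integrableZl mD M (integrable_abse (Iw j)).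
apply: (le_integrable mD _ _ I1).
  apply/measurable_EFinP; apply: measurable_funM; first by have /measurable_int/measurable_EFinP := Iw j.
  exact: measurable_funTS.
move=> x Dx; have M1 : 0 <= M by apply: M0; exists x.
rewrite /= lee_fin normrM [leRHS]ger0_norm ?mulr_ge0//.
by rewrite mulrC ler_wpM2r.
Qed.

Let pairing_le j M k : 0 <= M -> good M k ->
  `|pairing j k| <= M * \int[mu]_(x in D) `|w j x|.
Proof.
move=> M0 gk; have Ik := integrable_pairing j gk.
have Ia : mu.-integrable D (EFin \o (fun x => `|w j x|)) by exact: integrable_norm.
apply: le_trans (le_normr_Rintegral mD Ik) _.
rewrite -RintegralZl//; apply: le_Rintegral => //.
- exact: integrable_norm.
- by have := integrableZl mD M Ia.
by move=> x _; rewrite normrM mulrC ler_wpM2r//; case: gk.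
Qed.

(* Sokal's proof of the uniform boundedness principle: if the norms of w (J m)
   exceed m 3^m, add successively terms of size 3^-m, with signs chosen so that
   the later ones cannot cancel the pairing with w (J m). *)
Lemma uniform_boundedness_L1 :
  (forall k : T -> R, measurable_fun setT k -> (exists M, forall x, `|k x| <= M) ->
    exists M, forall j, `|\int[mu]_(x in D) (w j x * k x)| <= M) ->
  exists M, forall j, \int[mu]_(x in D) `|w j x| <= M.
Proof.
move=> bnd; apply: contrapT => nb.
pose N j := \int[mu]_(x in D) `|w j x|.
have /choice[J HJ] : forall m : nat, exists j, m%:R * 3 ^+ m < N j.
  move=> m; apply: contrapT => H; apply: nb; exists (m%:R * 3 ^+ m) => j.
  by rewrite leNgt; apply/negP => ?; apply: H; exists j.
(* The sign of [w (J m)], scaled by 3^-m: its pairing with [w (J m)] is 3^-m times the L^1 norm.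
   Extending [w] by 0 off D makes it measurable on the whole space. *)
pose s m x : R := 3^-1 ^+ m * (if 0 <= (w (J m) \_ D) x then 1 else -1).
pose step m (X : T -> R) : T -> R :=
  if `|pairing (J m) (fun x => X x + s m x)| < `|pairing (J m) (fun x => X x - s m x)|
  then fun x => X x - s m x else fun x => X x + s m x.
pose X := fix X m : T -> R := if m is l.+1 then step l (X l) else cst 0.
have p3 m : 0 <= 3^-1 ^+ m :> R by rewrite exprn_ge0// invr_ge0.
have gs m : good (3^-1 ^+ m) (s m).
  split=> [|x].
    apply: measurable_funM => //; apply: measurable_fun_ifT => //.
    apply: measurable_fun_ler => //; apply: (measurable_restrictT _ mD).1.
    by have /measurable_int/measurable_EFinP := Iw (J m).
  by rewrite /s normrM ger0_norm//; case: ifP => _; rewrite ?normrN normr1 mulr1.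
have Xstep m x : X m.+1 x - X m x = s m x \/ X m.+1 x - X m x = - s m x.
  by rewrite /= /step; case: ifP => _; [right|left]; ring.
have Xle m x : `|X m.+1 x - X m x| <= 3^-1 ^+ m.
  by have [_ /(_ x)] := gs m; case: (Xstep m x) => ->; rewrite ?normrN.
have mX m : measurable_fun setT (X m).
  elim: m => [|m IH]; first exact: measurable_cst.
  have [ms _] := gs m.
  by rewrite /= /step; case: ifP => _; [exact: measurable_funB|exact: measurable_funD].
(* The number 3/2 3^-m is the sum of 3^-l over l >= m. Correcting [X m] by it gives a monotone lower
   and a monotone upper sequence, and the supremum of the lower one is the limit, with an explicit
   rate. *)
have Xnd x : nondecreasing_seq (fun m => X m x - 3 / 2 * 3^-1 ^+ m).
  apply/nondecreasing_seqP => m; have := Xle m x.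
  by rewrite ler_norml exprS => /andP[+ _]; move: (p3 m); lra.
have Xni x : nonincreasing_seq (fun m => X m x + 3 / 2 * 3^-1 ^+ m).
  apply/nonincreasing_seqP => m; have := Xle m x.
  by rewrite ler_norml exprS => /andP[_]; move: (p3 m); lra.
have Xub x m l : X m x - 3 / 2 * 3^-1 ^+ m <= X l x + 3 / 2 * 3^-1 ^+ l.
  have := Xnd x _ _ (leq_maxl m l); have := Xni x _ _ (leq_maxr m l).
  by move: (p3 (maxn m l)); lra.
pose Y x : R := sup (range (fun m => X m x - 3 / 2 * 3^-1 ^+ m)).
have XY m x : `|Y x - X m x| <= 3 / 2 * 3^-1 ^+ m.
  have hs : has_sup (range (fun m => X m x - 3 / 2 * 3^-1 ^+ m)).
    split; first by exists (X 0%N x - 3 / 2 * 3^-1 ^+ 0), 0%N.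
    by exists (X 0%N x + 3 / 2 * 3^-1 ^+ 0) => _ [l _ <-].
  have h1 : X m x - 3 / 2 * 3^-1 ^+ m <= Y x.
    by apply: ub_le_sup; [case: hs|exists m].
  have h2 : Y x <= X m x + 3 / 2 * 3^-1 ^+ m.
    by apply: sup_le_ub; [case: hs|move=> _ [l _ <-]].
  by rewrite ler_norml; apply/andP; split; lra.
have c3 : (fun m => 3 / 2 * 3^-1 ^+ m : R) @ \oo --> 0.
  rewrite -(mulr0 (3 / 2)); apply: cvgMl_tmp.
  by apply: cvg_expr; rewrite ger0_norm ?invr_ge0// invf_lt1// ltr1n.
have mY : measurable_fun setT Y.
  apply: (measurable_fun_cvg mX) => x _.
  apply/cvgrPdist_lt => e e0; near=> m.
  by apply: le_lt_trans (XY m x) _; near: m; exact: (cvgr_lt _ c3).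
have Yb : forall x, `|Y x| <= 3 / 2.
  by move=> x; have := XY 0%N x; rewrite expr0 mulr1 /= subr0.
have [M HM] := bnd Y mY (ex_intro _ _ Yb).
have gX m : good 3 (X m).
  split=> // x; have := XY m x; have := Yb x.
  have h3 : 3^-1 ^+ m <= 1 :> R by rewrite exprn_ile1// ?invr_ge0// invf_le1// ler1n.
  rewrite !ler_norml => /andP[? ?] /andP[? ?]; apply/andP; split; lra.
have Npos j : 0 <= N j by apply: Rintegral_ge0.
have pD j M1 M2 k1 k2 : good M1 k1 -> good M2 k2 ->
    pairing j (fun x => k1 x + k2 x) = pairing j k1 + pairing j k2.
  move=> g1 g2; rewrite /pairing -RintegralD//.
  - by apply: eq_Rintegral => x _; rewrite mulrDr.
  - exact: integrable_pairing g1.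
  - exact: integrable_pairing g2.
have pB j M1 M2 k1 k2 : good M1 k1 -> good M2 k2 ->
    pairing j (fun x => k1 x - k2 x) = pairing j k1 - pairing j k2.
  move=> g1 g2; rewrite /pairing -RintegralB//.
  - by apply: eq_Rintegral => x _; rewrite mulrBr.
  - exact: integrable_pairing g1.
  - exact: integrable_pairing g2.
have ps m : pairing (J m) (s m) = 3^-1 ^+ m * N (J m).
  rewrite /pairing /N -RintegralZl//; last exact: integrable_norm.
  apply: eq_Rintegral => x xD; rewrite /s patchE xD mulrCA; congr (_ * _).
  by case: ifPn => [h|]; [rewrite mulr1 ger0_norm|
    rewrite -ltNge => h; rewrite mulrN1 ltr0_norm].
(* of the two candidates X m + s m and X m - s m, one pairs with w (J m) to at
   least the pairing of s m *)
have pX m : 3^-1 ^+ m * N (J m) <= `|pairing (J m) (X m.+1)|.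
  have E1 := pD (J m) _ _ _ _ (gX m) (gs m); have E2 := pB (J m) _ _ _ _ (gX m) (gs m).
  rewrite -ps /= /step E1 E2.
  set A := pairing _ (X m) in E1 E2 *; set B := pairing _ (s m) in E1 E2 *.
  have := ler_norm (A + B); have := ler_norm (- (A - B)); rewrite normrN => h1 h2.
  by case: ltP => h; rewrite ?E1 ?E2; lra.
(* The corrections after step m have size at most 3/2 3^-(m+1) = 3^-m / 2, so they undo at most half
   of the pairing secured by [pX]; the remaining half is at least m/2 by the choice of [J m]. *)
have key m : m%:R / 2 <= `|pairing (J m) Y|.
  have gYX : good (3 / 2 * 3^-1 ^+ m.+1) (fun x => Y x - X m.+1 x).
    by split; [exact: measurable_funB|exact: XY].
  have gY : good (3 / 2) Y by [].
  have := pairing_le (J m) _ gYX; rewrite (pB _ _ _ _ _ gY (gX m.+1)) -/(N _).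
  rewrite mulr_ge0// => /(_ isT) h.
  have := ler_distD (pairing (J m) Y) (pairing (J m) (X m.+1)) 0.
  have := pX m; rewrite !subr0 distrC exprS in h * => h1 h2.
  have h3 : m%:R <= 3^-1 ^+ m * N (J m).
    have := ltW (HJ m); rewrite -ler_pdivlMr ?exprn_gt0// mulrC exprVn; exact.
  move: h; rewrite (_ : _ * N (J m) = 3^-1 ^+ m * N (J m) / 2); last by field.
  by lra.
have [m Hm] : exists m : nat, 2 * M < m%:R.
  exists (Num.bound `|2 * M|); apply: le_lt_trans (ler_norm _) _; exact: archi_boundP.
have := le_trans (key m) (HM (J m)); lra.
Unshelve. all: by end_near. Qed.
End GlidingHump.

(** * Integration over sets of finite measure as a functional on L^p *)

Section LpFunctionals.
Context d (T : measurableType d) {R : realType} (mu : {measure set T -> \bar R}).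
Variables (D : set T) (mD : measurable D) (Dfin : (mu D < +oo)%E) (p : R) (p1 : 1 <= p).

Let p0 : 0 < p. Proof. exact: lt_le_trans p1. Qed.

Lemma measurable_Lfun (f : T -> R) : f \in Lfun mu p%:E -> measurable_fun setT f.
Proof. by move=> /sub_Lfun_mfun; rewrite inE. Qed.

Lemma Lnorm_Lfun (f : T -> R) : f \in Lfun mu p%:E ->
  ('N[mu]_p%:E[EFin \o f] = (fine 'N[mu]_p%:E[EFin \o f])%:E)%E.
Proof.
move=> /sub_Lfun_finLfun; rewrite inE /finite_norm => fp.
by rewrite fineK// ge0_fin_numE// Lnorm_ge0.
Qed.

Lemma integral_powR_Lnorm (f : T -> R) : f \in Lfun mu p%:E ->
  (\int[mu]_x (`|f x| `^ p)%:E = (fine 'N[mu]_p%:E[EFin \o f]%E `^ p)%:E)%E.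
Proof.
move=> fp; have := @poweR_Lnorm _ _ _ mu (EFin \o f) p; rewrite gt_eqF// => /(_ isT).
by rewrite (Lnorm_Lfun fp) poweR_EFin => ->.
Qed.

(* Hoelder's inequality with a worse constant, uniformly in p: for s > |f|_p,
   |f| <= s (1 + (|f| / s) ^ p). *)
Lemma Lp_integral_abs_le (f : T -> R) : f \in Lfun mu p%:E ->
  (\int[mu]_(x in D) `|f x|%:E <= (fine (mu D) + 1)%:E * 'N[mu]_p%:E[EFin \o f])%E.
Proof.
move=> fp; have mf := measurable_Lfun fp.
have := Lnorm_Lfun fp; have := integral_powR_Lnorm fp.
have N0 : 0 <= fine 'N[mu]_p%:E[EFin \o f]%E by rewrite fine_ge0// Lnorm_ge0.
move: N0; set N := fine _ => N0 HN ->.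
have D0 : 0 <= fine (mu D) by rewrite fine_ge0.
have main (e : R) : 0 < e ->
    (\int[mu]_(x in D) `|f x|%:E <= ((fine (mu D) + 1) * (N + e))%:E)%E.
  (* The slack [e] keeps [s] positive when the norm vanishes. Integrating |f| <= s + s (|f| / s)^p
     bounds the left side by s (mu D + 1), and [e] is let go to 0 at the end. *)
  move=> e0; set s := N + e; have s0 : 0 < s by rewrite ltr_wpDl.
  have mfp : measurable_fun setT (fun x => (`|f x| `^ p)%:E).
    apply/measurable_EFinP; apply: (measurableT_comp (measurable_powR _)).
    exact: measurableT_comp.
  apply: (@le_trans _ _ (\int[mu]_(x in D)
      (s%:E + (s * s^-1 `^ p)%:E * (`|f x| `^ p)%:E))%E).
    apply: ge0_le_integral => //.
    - apply/measurable_EFinP; apply: measurableT_comp => //; exact: measurable_funTS.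
    - apply: emeasurable_funD => //; apply: measurable_funeM; exact: measurable_funTS.
    move=> x _; rewrite -EFinM -EFinD lee_fin.
    have [h|/ltW h] := leP `|f x| s.
      by apply: le_trans h _; rewrite lerDl !mulr_ge0 ?powR_ge0 ?(ltW s0).
    apply: (@le_trans _ _ (s * s^-1 `^ p * `|f x| `^ p)); last by rewrite lerDr ltW.
    rewrite -mulrA -powRM ?invr_ge0 ?(ltW s0)// -ler_pdivrMl//.
    by apply: le1r_powR => //; rewrite mulrC ler_pdivlMr// mul1r.
  have c0 : 0 <= s * s^-1 `^ p by rewrite mulr_ge0 ?powR_ge0 ?(ltW s0).
  have mfpD : measurable_fun D (fun x => (`|f x| `^ p)%:E) by exact: measurable_funTS.
  rewrite ge0_integralD//; first last.
  - exact: measurable_funeM.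
  - by move=> x _; rewrite -EFinM lee_fin mulr_ge0 ?powR_ge0.
  - by move=> x _; rewrite lee_fin ltW.
  rewrite integral_cst// ge0_integralZl ?lee_fin//.
  apply: (@le_trans _ _ (s%:E * mu D + (s * s^-1 `^ p)%:E * (N `^ p)%:E)%E).
    rewrite leeD2l// lee_wpmul2l ?lee_fin//.
    rewrite -HN; exact: ge0_subset_integral.
  rewrite -[mu D]fineK ?ge0_fin_numE// -!EFinM -EFinD lee_fin.
  rewrite [leRHS]mulrDl mul1r [s * fine _]mulrC lerD2l -mulrA -powRM ?invr_ge0 ?(ltW s0)//.
  rewrite ler_piMr ?(ltW s0)//.
  have -> : 1 = 1 `^ p :> R by rewrite powR1.
  apply: ge0_ler_powR; rewrite ?nnegrE ?mulr_ge0 ?invr_ge0 ?(ltW s0) ?(ltW p0)//.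
  by rewrite mulrC ler_pdivrMr// mul1r lerDl ltW.
rewrite -EFinM; apply/lee_addgt0Pr => e e0.
have c0 : 0 < fine (mu D) + 1 by rewrite ltr_wpDl.
have := main (e / (fine (mu D) + 1)); rewrite divr_gt0// => /(_ isT).
by rewrite mulrDr mulrCA mulfV ?gt_eqF// mulr1 -EFinD.
Qed.

Lemma Lfun_integrable_in (f : T -> R) : f \in Lfun mu p%:E ->
  mu.-integrable D (EFin \o f).
Proof.
move=> fp; apply/integrableP; split.
  by apply/measurable_EFinP/measurable_funTS; exact: measurable_Lfun.
apply: le_lt_trans (Lp_integral_abs_le fp) _.
by rewrite (Lnorm_Lfun fp) -EFinM ltry.
Qed.

Lemma integrableM_bounded (f k : T -> R) (M : R) : mu.-integrable D (EFin \o f) ->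
  measurable_fun setT k -> (forall x, `|k x| <= M) ->
  mu.-integrable D (EFin \o (fun x => f x * k x)).
Proof.
move=> If mk kM.
have := @integrableMl _ _ _ mu D mD (EFin \o f) k If (measurable_funTS mk).
apply; exists M; split; first exact: num_real.
by move=> y My x _; apply: le_trans (kM x) (ltW My).
Qed.

End LpFunctionals.

Section WeakPairing.
Context {R : realType} {n : nat}.
Local Notation mu := (@lebesgue_rV R n).

(** Pairing with [k] over D is a bounded functional of norm at most M (mu D + 1), by the L^1 bound
    on D. *)
Lemma weak_cvg_Lp_pairing (p : R) (D : set 'rV[R]_n) (u_ : nat -> 'rV[R]_n -> R) u
    (k : 'rV[R]_n -> R) (M : R) : 1 <= p -> measurable D -> (mu D < +oo)%E ->
  weak_cvg_Lp p u_ u -> measurable_fun setT k -> (forall x, `|k x| <= M) ->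
  (fun j => \int[mu]_(x in D) (u_ j x * k x)) @ \oo --> \int[mu]_(x in D) (u x * k x).
Proof.
move=> p1 mD Dfin [uj up wk] mk kM.
apply: (wk (fun f => \int[mu]_(x in D) (f x * k x))); split.
  move=> a f h fp hp.
  have If := integrableM_bounded mD (Lfun_integrable_in mD Dfin p1 fp) mk kM.
  have Ih := integrableM_bounded mD (Lfun_integrable_in mD Dfin p1 hp) mk kM.
  rewrite -RintegralZl// -RintegralD//; last exact: (integrableZl mD a If).
  by apply: eq_Rintegral => x _; rewrite mulrDl mulrA.
have M0 : 0 <= M by apply: le_trans (kM 0).
exists (M * (fine (mu D) + 1)) => f fp.
have I0 := Lfun_integrable_in mD Dfin p1 fp.
have If := integrableM_bounded mD I0 mk kM.
rewrite EFin_normr_Rintegral//.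
apply: le_trans (le_abse_integral _ mD (measurable_int _ If)) _.
rewrite EFinM -muleA.
apply: le_trans (lee_wpmul2l _ (Lp_integral_abs_le mD Dfin p1 fp)); last by rewrite lee_fin.
rewrite -ge0_integralZl//; last first.
  by have := measurable_int _ (integrable_abse I0).
apply: ge0_le_integral => //.
- by have := measurable_int _ (integrable_abse If).
- by apply: measurable_funeM; have := measurable_int _ (integrable_abse I0).
by move=> x _; rewrite -EFinM lee_fin normrM mulrC ler_wpM2r.
Qed.

End WeakPairing.

(** * The fractional gradient away from the support *)

Section TruncatedKernel.
Context {R : realType} {n : nat}.
Implicit Types (x y z : 'rV[R]_n) (i : 'I_n).
Local Notation mu := (@lebesgue_rV R n).
Variables (alpha eta : R) (a0 : 0 < alpha) (eta0 : 0 < eta).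

(** Equal to the Riesz kernel for points at least [eta] apart, yet bounded on the whole space: it is
    an admissible weight in [weak_cvg_Lp_pairing] whatever the base point. *)
Definition tker i z : R := if eta <= `|z| then rker alpha i z else 0.

Definition tker_bound : R := eta `^ (- (n%:R + alpha)).

Lemma tker_bound_ge0 : 0 <= tker_bound. Proof. exact: powR_ge0. Qed.

Lemma measurable_tker i : measurable_fun setT (tker i).
Proof.
apply: measurable_fun_ifT => //; last exact: measurable_rker.
by apply: measurable_fun_ler => //; exact: measurable_norm_rV.
Qed.

Lemma tker_le i z : `|tker i z| <= tker_bound.
Proof.
rewrite /tker; case: ifPn => h; last by rewrite normr0 tker_bound_ge0.
apply: le_trans (rker_le i z a0) _; apply: powRN_le => //.
by rewrite addr_ge0// ltW.
Qed.

Variables (w : 'rV[R]_n -> R) (D : set 'rV[R]_n) (mD : measurable D).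
Hypothesis Iw : mu.-integrable D (EFin \o w).

(* For w supported in D, - riesz_cst times this is the fractional gradient of w
   at the points z at distance at least eta from D. *)
Definition tail_potential i z : R := \int[mu]_(y in D) (w y * tker i (z - y)).

Let mtl i z : measurable_fun setT (fun y => tker i (z - y)).
Proof. by apply: (measurableT_comp (measurable_tker i)); exact: measurable_sub_rV. Qed.

Lemma integrable_tail i z : mu.-integrable D (EFin \o (fun y => w y * tker i (z - y))).
Proof.
apply: (@integrableM_bounded _ _ _ mu D mD w _ tker_bound) => // y; exact: tker_le.
Qed.

Lemma tail_potential_le i z (M : R) : 0 <= M ->
  (forall y, D y -> `|tker i (z - y)| <= M) ->
  `|tail_potential i z| <= M * \int[mu]_(y in D) `|w y|.
Proof.
move=> M0 HM; have Ia := integrable_norm Iw.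
apply: le_trans (le_normr_Rintegral mD (integrable_tail i z)) _.
rewrite -RintegralZl//; apply: le_Rintegral => //.
- exact: integrable_norm (integrable_tail i z).
- exact: (integrableZl mD M Ia).
by move=> y Dy; rewrite normrM mulrC ler_wpM2r// HM.
Qed.

Section Fubini.
Variables (i : 'I_n) (psi : 'rV[R]_n -> R) (B : set 'rV[R]_n).
Hypotheses (mpsi : measurable_fun setT psi) (mB : measurable B).
Hypotheses (Bfin : (mu B < +oo)%E) (psiB : forall z, `|psi z| <= \1_B z).

Let W := w \_ D.

Let mW : measurable_fun setT W.
Proof.
apply: (measurable_restrictT _ mD).1.
by have /measurable_int/measurable_EFinP := Iw.
Qed.

Let IW : mu.-integrable setT (EFin \o W).
Proof.
have := (integrable_mkcond _ mD).1 Iw; rewrite (_ : (EFin \o w) \_ D = EFin \o W)//.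
by apply/funext => x; rewrite /W /= !patchE; case: ifP.
Qed.

Let f (yz : 'rV[R]_n * 'rV[R]_n) : R := W yz.1 * (psi yz.2 * tker i (yz.2 - yz.1)).

Let mf : measurable_fun setT f.
Proof.
apply: measurable_funM; first exact: (measurableT_comp mW measurable_fst).
apply: measurable_funM; first exact: (measurableT_comp mpsi measurable_snd).
exact: (measurableT_comp (measurable_tker i) measurable_sub21).
Qed.

Let fle y z : `|f (y, z)| <= `|W y| * tker_bound * \1_B z.
Proof.
rewrite /f /= normrM -mulrA ler_wpM2l// normrM mulrC.
by rewrite ler_pM// tker_le.
Qed.

Let If : (mu \x mu)%E.-integrable setT (EFin \o f).
Proof.
apply/integrable12ltyP; first exact/measurable_EFinP.
have mI : measurable_fun setT (fun z : 'rV[R]_n => (\1_B z)%:E : \bar R).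
  by apply/measurable_EFinP; exact: measurable_indic.
apply: (@le_lt_trans _ _ (\int[mu]_y ((tker_bound%:E * mu B) * `|(W y)%:E|))%E).
  apply: ge0_le_integral => //.
  - by move=> y _; exact: integral_ge0.
  - apply: (measurable_fun_fubini_tonelli_F (abse \o (EFin \o f))) => //=.
    by apply: measurableT_comp => //; exact/measurable_EFinP.
  - apply: measurable_funeM; apply: measurableT_comp => //; exact/measurable_EFinP.
  move=> y _.
  apply: (@le_trans _ _ (\int[mu]_z ((`|W y| * tker_bound)%:E * (\1_B z)%:E))%E).
    apply: ge0_le_integral => //.
    - apply: measurableT_comp => //; apply/measurable_EFinP.
      by apply: (measurableT_comp mf); exact: measurable_fun_pair.
    - exact: measurable_funeM.
    by move=> z _; rewrite -EFinM lee_fin; exact: fle.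
  rewrite ge0_integralZl// ?lee_fin ?mulr_ge0 ?tker_bound_ge0//.
  by rewrite integral_indic// setIT EFinM -muleA muleC.
have [_ Wfin] := integrableP _ _ _ IW.
have tb0 : (0 <= tker_bound%:E * mu B)%E by rewrite mule_ge0 ?lee_fin ?tker_bound_ge0.
rewrite ge0_integralZl//; last first.
  by apply: measurableT_comp => //; exact/measurable_EFinP.
apply: lte_mul_pinfty => //.
by rewrite fin_numM// ge0_fin_numE.
Qed.

Let innerE y : fubini_F mu (EFin \o f) y =
  (W y * \int[mu]_z (psi z * tker i (z - y)))%:E.
Proof.
have Ip : mu.-integrable setT (EFin \o (fun z => psi z * tker i (z - y))).
  have mpt : measurable_fun setT (fun z => psi z * tker i (z - y)).
    apply: measurable_funM => //; apply: (measurableT_comp (measurable_tker i)).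
    exact: measurable_sub_rV.
  have IB : mu.-integrable setT (fun z => (tker_bound * \1_B z)%:E).
    apply: (integrableZl measurableT tker_bound (f := fun z => (\1_B z)%:E)).
    apply/integrableP; split; first by apply/measurable_EFinP; exact: measurable_indic.
    under eq_integral => z _ do rewrite gee0_abs ?lee_fin//.
    by rewrite integral_indic// setIT.
  apply: (le_integrable measurableT _ _ IB); first exact/measurable_EFinP.
  move=> z _; rewrite /= lee_fin normrM [leRHS]ger0_norm ?mulr_ge0 ?tker_bound_ge0//.
  by rewrite mulrC ler_pM// tker_le.
rewrite /fubini_F /f /= EFinM /Rintegral fineK; last exact: integrable_fin_num.
by rewrite -integralZl//.
Qed.

Let innerG z : fubini_G mu (EFin \o f) z = (tail_potential i z * psi z)%:E.
Proof.
rewrite /fubini_G /tail_potential.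
have It := integrable_tail i z.
rewrite EFinM /Rintegral fineK; last exact: integrable_fin_num.
rewrite -integralZr// [RHS]integral_mkcond; apply: eq_integral => y _.
rewrite patchE /f /W /= patchE; case: ifP => _; last by rewrite mul0r.
by rewrite -EFinM; congr (_%:E); ring.
Qed.

(** The assumption that [psi] is dominated by an indicator covers both cases of interest: bumps, for
    the weak identity, and the indicator of a box, for the integrability of the potential on that
    box. *)
Lemma integrable_tail_potential_psi :
  mu.-integrable setT (EFin \o (fun z => tail_potential i z * psi z)).
Proof.
have -> : EFin \o (fun z => tail_potential i z * psi z) = fubini_G mu (EFin \o f).
  by apply/funext => z; rewrite innerG.
have mfe : measurable_fun setT (EFin \o f) by exact/measurable_EFinP.
apply/integrableP; split; first exact: measurable_fubini_G If.
have /(integrable21ltyP mu mu mfe) H := If.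
apply: le_lt_trans H; apply: ge0_le_integral => //.
- by apply: measurableT_comp => //; exact: measurable_fubini_G If.
- apply: (measurable_fun_fubini_tonelli_G (abse \o (EFin \o f))) => //=.
  exact: measurableT_comp.
move=> z _; apply: le_abse_integral => //; apply/measurable_EFinP.
by apply: (measurableT_comp mf); exact: measurable_fun_pair.
Qed.

Lemma integrableM_psi : mu.-integrable D
  (EFin \o (fun y => w y * \int[mu]_z (psi z * tker i (z - y)))).
Proof.
have I1 := integrableS measurableT mD (@subsetT _ D) (integrable_fubini_F If).
apply: eq_integrable I1 => // y yD; rewrite innerE /W patchE yD//.
Qed.

Lemma Fubini_tail_potential :
  \int[mu]_(y in D) (w y * \int[mu]_z (psi z * tker i (z - y))) =
  \int[mu]_z (tail_potential i z * psi z).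
Proof.
rewrite /Rintegral; congr fine.
under [RHS]eq_integral => z _ do rewrite -innerG.
rewrite integral21_prod_meas1// -integral12_prod_meas1//.
rewrite integral_mkcond; apply: eq_integral => y _.
rewrite innerE patchE /W patchE; case: ifP => _ //.
by rewrite mul0r.
Qed.

End Fubini.
End TruncatedKernel.

(** * The difference of two weak gradients as a potential *)

Section Identification.
Context {R : realType} {n : nat}.
Implicit Types (x y z : 'rV[R]_n) (i : 'I_n).
Local Notation mu := (@lebesgue_rV R n).

Lemma integrable_L1_loc_obox (v : 'rV[R]_n -> 'rV[R]_n) A C i : L1_loc v ->
  mu.-integrable (obox A C) (EFin \o (fun x => v x ord0 i)).
Proof.
move=> [mv vloc]; have mB := measurable_obox A C.
set K := [set x : 'rV[R]_n | forall i, x ord0 i \in `[A ord0 i, C ord0 i]].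
have cK : compact K.
  apply: (@rV_compact _ _ (fun i => `[A ord0 i, C ord0 i]%classic)) => j.
  exact: segment_compact.
have BK : obox A C `<=` K.
  by move=> x Bx j; have /andP[/ltW ? /ltW ?] := Bx j; rewrite in_itv/=; apply/andP.
have mK : measurable K.
  have clK : closed K by exact: compact_closed cK.
  by rewrite -(setCK K); apply: measurableC; apply: open_measurable_rV; exact: closed_openC.
have mvi : measurable_fun setT (fun x => v x ord0 i).
  exact: (measurableT_comp (measurable_coord i) mv).
have mev : measurable_fun setT (fun x => (enorm (v x))%:E : \bar R).
  apply/measurable_EFinP; exact: (measurableT_comp measurable_enorm mv).
apply/integrableP; split; first by apply/measurable_EFinP; exact: measurable_funTS.
apply: le_lt_trans (vloc K cK).
apply: (@le_trans _ _ (\int[mu]_(x in obox A C) (enorm (v x))%:E)%E).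
  apply: ge0_le_integral => //.
  - by apply: measurableT_comp => //; apply/measurable_EFinP; exact: measurable_funTS.
  - exact: measurable_funTS.
  by move=> x _; rewrite /= lee_fin ler_coord_enorm.
apply: ge0_subset_integral => //; first exact: measurable_funTS.
by move=> x _; rewrite lee_fin enorm_ge0.
Qed.

Variables (alpha p eta : R) (a01 : 0 < alpha < 1) (p1 : 1 <= p) (eta0 : 0 < eta).
Variables (D : set 'rV[R]_n) (mD : measurable D) (Dfin : (mu D < +oo)%E).
Variables (u1 u2 : 'rV[R]_n -> R) (v1 v2 : 'rV[R]_n -> 'rV[R]_n).
Hypotheses (Lu1 : Lp p%:E u1) (Lu2 : Lp p%:E u2).
Hypotheses (g1 : is_weak_frac_grad alpha u1 v1) (g2 : is_weak_frac_grad alpha u2 v2).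
Hypothesis u12 : {ae mu, forall x, (~` D) x -> u1 x = u2 x}.
Variables (A C : 'rV[R]_n) (AC : forall i, A ord0 i < C ord0 i).
Hypothesis far : forall z y, obox A C z -> D y -> eta <= `|z - y|.

Let w x := u1 x - u2 x.
Let a0 : 0 < alpha. Proof. by have /andP[] := a01. Qed.

Lemma integrable_Lp_sub : mu.-integrable D (EFin \o w).
Proof.
have I1 := Lfun_integrable_in mD Dfin p1 Lu1.
have I2 := Lfun_integrable_in mD Dfin p1 Lu2.
exact: (integrableB mD I1 I2).
Qed.

Let Iw := integrable_Lp_sub.
Let c := @riesz_cst R n alpha.
Let tail i z := tail_potential alpha eta w D i z.

Section TestBump.
Variables (a b : 'rV[R]_n) (k : nat) (i : 'I_n).
Hypotheses (ab : forall i, a ord0 i < b ord0 i) (sub : obox a b `<=` obox A C).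
Let phi := rbump k a b.

Let phi1 z : `|phi z| <= \1_(obox a b) z.
Proof.
have /andP[p0 pl] := bump_itv k a b z; rewrite ger0_norm// indicE.
case: (pselect (obox a b z)) => h; first by rewrite mem_set.
by rewrite memNset// /phi bump_out.
Qed.

Let riesz_far y : D y ->
  riesz_grad alpha phi y ord0 i = c * \int[mu]_z (phi z * tker alpha eta i (z - y)).
Proof.
move=> Dy; rewrite riesz_gradE; congr (_ * _); apply: eq_Rintegral => z _.
have nb x : obox a b x -> D x -> False.
  move=> ax Dx; have := far (sub ax) Dx.
  by rewrite subrr normr0 leNgt eta0.
rewrite (_ : phi y = 0) ?subr0; last by apply: bump_out => // /nb/(_ Dy).
case: (pselect (obox a b z)) => h; last by rewrite /phi (bump_out k ab h) !mul0r.
by rewrite /tker (far (sub h) Dy).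
Qed.

(** Almost everywhere agreement off D restricts the left side to D. There the bump vanishes, so its
    Riesz gradient loses the subtracted term and involves only distances at least [eta], where the
    truncated kernel is the true one. Fubini then moves the kernel onto [w]. *)
Lemma integral_weak_riesz_bump :
  \int[mu]_x (u1 x * riesz_grad alpha phi x ord0 i) -
  \int[mu]_x (u2 x * riesz_grad alpha phi x ord0 i) =
  c * \int[mu]_z (tail i z * phi z).
Proof.
have I1 := integrable_Lp_riesz_bump i k a01 ab p1 Lu1.
have I2 := integrable_Lp_riesz_bump i k a01 ab p1 Lu2.
have I3 := integrableM_psi a0 eta0 mD Iw i (measurable_bump k a b)
  (measurable_obox a b) (lebesgue_obox_lty ab) phi1.
rewrite -RintegralB//.
transitivity (\int[mu]_(x in D) (c * (w x *
    \int[mu]_z (phi z * tker alpha eta i (z - x))))); last first.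
  rewrite RintegralZl//; congr (_ * _).
  exact: (Fubini_tail_potential a0 eta0 mD Iw i (measurable_bump k a b)
      (measurable_obox a b) (lebesgue_obox_lty ab) phi1).
rewrite [RHS]Rintegral_mkcond; congr fine; apply: ae_eq_integral => //.
- exact: measurable_int (integrableB measurableT I1 I2).
- apply/measurable_EFinP; apply: (measurable_restrictT _ mD).1.
  by apply/measurable_EFinP; exact: measurable_int (integrableZl mD c I3).
apply: filterS u12 => x ux _; rewrite patchE.
case: ifPn => [|] xD.
  by rewrite inE in xD; rewrite /= (riesz_far xD) -mulrBl mulrCA.
by rewrite /= ux ?subrr//=; move/negP: xD => + Dx; apply; apply/mem_set.
Qed.

End TestBump.

(** The difference [h] of the two sides, cut off to the box to be integrable, pairs to 0 with every
    bump inside the box. The minus sign is that of the integration by parts defining the weak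
    gradient. *)
Lemma weak_frac_grad_diff i : {ae mu, forall x, obox A C x ->
  v1 x ord0 i - v2 x ord0 i = - c * tail i x}.
Proof.
set B := obox A C; have mB : measurable B := measurable_obox A C.
have Bfin := lebesgue_obox_lty AC.
have [[_ L1 W1] [_ L2 W2]] := (g1, g2).
have Iv1 := integrable_L1_loc_obox A C i L1.
have Iv2 := integrable_L1_loc_obox A C i L2.
have IF : mu.-integrable setT (EFin \o (fun z => tail i z * \1_B z)).
  apply: (integrable_tail_potential_psi a0 eta0 mD Iw i (measurable_indic mB) mB Bfin).
  by move=> z; rewrite ger0_norm.
pose h x := (v1 x ord0 i - v2 x ord0 i) * \1_B x + c * (tail i x * \1_B x).
have restr (f : 'rV[R]_n -> R) : mu.-integrable B (EFin \o f) ->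
    mu.-integrable setT (EFin \o (fun x => f x * \1_B x)).
  move=> /(integrable_mkcond _ mB).1; congr (integrable _ _ _).
  by apply/funext => x; rewrite patchE /= indicE; case: ifP => _; rewrite ?mulr1 ?mulr0.
have Iv : mu.-integrable setT (EFin \o (fun x => (v1 x ord0 i - v2 x ord0 i) * \1_B x)).
  by apply: restr; exact: (integrableB mB Iv1 Iv2).
have Ih : mu.-integrable setT (EFin \o h).
  exact: (integrableD measurableT Iv (integrableZl measurableT c IF)).
have bump_bnd a b k x : `|rbump k a b x| <= 1.
  by have /andP[? ?] := bump_itv k a b x; rewrite ger0_norm.
have h0 (a b : 'rV[R]_n) k : (forall j, a ord0 j < b ord0 j) -> obox a b `<=` B ->
    \int[mu]_x (h x * rbump k a b x) = 0.
  move=> ab sub.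
  have zero x : \1_B x * rbump k a b x = rbump k a b x.
    rewrite indicE; case: (pselect (obox a b x)) => xab.
      by rewrite mem_set ?mul1r//; exact: sub.
    by rewrite (bump_out k ab xab) mulr0.
  have bm (f : 'rV[R]_n -> R) : mu.-integrable setT (EFin \o (fun x => f x * \1_B x)) ->
      mu.-integrable setT (EFin \o (fun x => f x * rbump k a b x)).
    move=> If; rewrite (_ : (fun x => _) = fun x => f x * \1_B x * rbump k a b x).
      exact: integrableM_bounded If (measurable_bump k a b) (bump_bnd a b k).
    by apply/funext => x; rewrite -mulrA zero.
  have t := test_function_bump k ab.
  have J1 := bm _ (restr _ Iv1); have J2 := bm _ (restr _ Iv2); have J3 := bm _ IF.
  have E := integral_weak_riesz_bump k i ab sub.
  transitivity (\int[mu]_x ((v1 x ord0 i * rbump k a b x - v2 x ord0 i * rbump k a b x)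
     + c * (tail i x * rbump k a b x))).
    apply: eq_Rintegral => x _; rewrite /h mulrDl -!mulrA zero; ring.
  rewrite RintegralD//; last 2 first.
  - exact: (integrableB measurableT J1 J2).
  - exact: (integrableZl measurableT c J3).
  rewrite RintegralB// RintegralZl// -E W1// W2//; ring.
have := ae0_of_rbump Ih h0; apply: filterS => x hx Bx.
move: (hx Bx); rewrite /h indicE mem_set// !mulr1 => /eqP.
by rewrite addr_eq0 mulNr => /eqP.
Qed.

End Identification.

Lemma powR_cvg0_seq {R : realType} (a : nat -> R) (r : R) : 0 < r ->
  (forall j, 0 <= a j) -> a @ \oo --> 0 -> (fun j => a j `^ r) @ \oo --> 0.
Proof.
move=> r0 a0 ca; apply/cvgrPdist_lt => e e0.
have d0 : 0 < e `^ r^-1 by rewrite powR_gt0.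
near=> j; rewrite sub0r normrN ger0_norm ?powR_ge0//.
have -> : e = (e `^ r^-1) `^ r by rewrite -powRrM mulVf ?gt_eqF// powRr1// ltW.
apply: gt0_ltr_powR => //; rewrite ?nnegrE ?powR_ge0//.
by near: j; exact: (cvgr_lt _ ca).
Unshelve. all: by end_near. Qed.

(** * Separation of sets, and almost everywhere statements on small boxes *)

Section Geometry.
Context {R : realType} {n : nat}.
Implicit Types (x y z : 'rV[R]_n).
Local Notation mu := (@lebesgue_rV R n).

Lemma norm_le_sum_coord z : `|z| <= \sum_i `|z ord0 i|.
Proof.
apply/rV_norm_leP; first exact: sumr_ge0.
by move=> i; rewrite (bigD1 i)//= lerDl sumr_ge0.
Qed.

Lemma enorm_le z : enorm z <= Num.sqrt n%:R * \sum_i `|z ord0 i|.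
Proof.
apply: (@le_trans _ _ (Num.sqrt n%:R * `|z|)); last first.
  by rewrite ler_wpM2l ?sqrtr_ge0 ?norm_le_sum_coord.
rewrite -[`|z|]ger0_norm// -sqrtr_sqr -sqrtrM// ler_wsqrtr//.
rewrite -[n in n%:R]card_ord -sumr_const mulr_suml; apply: ler_sum => i _.
by rewrite mul1r -real_normK ?num_real// lerXn2r ?nnegrE// ler_coord_norm.
Qed.

(** Around each point of the closure a ball of radius e lies in the open set, so the claim holds
    near that point for all small enough distances; compactness, as a near-covering property, gives
    one distance for all points. *)
Lemma compactly_contained_dist (D D' : set 'rV[R]_n) : open D' ->
  compactly_contained D D' -> exists2 e : R, 0 < e &
    forall x y, D y -> ~ D' x -> e <= `|x - y|.
Proof.
move=> oD' [cK KD'].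
have /= H := (compact_near_coveringP _).1 cK _ (0 : R)^'+
  (fun e y => forall x, `|x - y| < e -> D' x) _ _.
have {}H : \forall e \near (0 : R)^'+, closure D `<=` (fun y => forall x, `|x - y| < e -> D' x).
  apply: H => y Ky.
  have /nbhs_ballP[e /= e0 ye] : nbhs y D'.
    by apply: open_nbhs_nbhs; split=> //; exact: KD'.
  have e20 : 0 < e / 2 by rewrite divr_gt0.
  exists (ball y (e / 2), [set t | t < e / 2]) => /=.
    by split; [exact: nbhsx_ballx|exact: nbhs_right_lt].
  move=> [y' t] [/= yy' te] x xy'; apply: ye.
  rewrite -ball_normE /= in yy' *.
  apply: le_lt_trans (ler_distD y' _ _) _.
  by rewrite [X in _ < X](splitr e) ltrD// distrC (lt_trans xy').
have [e [e0 He]] := filter_ex (filterI (nbhs_right_gt (0 : R)) H).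
exists e => // x y Dy D'x; rewrite leNgt; apply/negP => xy; apply: D'x.
by apply: (He y) => //; exact: subset_closure.
Qed.

Lemma bounded_set_cbox (D : set 'rV[R]_n) : bounded_set D ->
  exists2 r : R, 0 <= r & forall y, D y -> `|y| <= r.
Proof.
move=> [M [_ HM]]; exists (`|M| + 1) => [|y Dy]; first by rewrite addr_ge0.
by apply: HM Dy; rewrite (le_lt_trans (ler_norm M))// ltrDl.
Qed.

Lemma lebesgue_bounded_lty (D : set 'rV[R]_n) : measurable D -> bounded_set D ->
  (mu D < +oo)%E.
Proof.
move=> mD /bounded_set_cbox[r r0 Dr].
apply: (@le_lt_trans _ _ ((mu : {measure set _ -> \bar R}) (cbox 0 r))).
  apply: le_measure; rewrite ?inE//; first exact: measurable_cbox.
  by move=> y Dy; rewrite /cbox /= subr0 Dr.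
by rewrite lebesgue_cbox// ltry.
Qed.

(** Boxes of side [e] with rational centres are countably many, so their exceptional null sets can
    be united. Only boxes meeting S count, and all their points are within [e] of a point of S,
    which in the application keeps them away from Omega. *)
Lemma ae_rational_box (P : 'rV[R]_n -> Prop) (S : set 'rV[R]_n) (e : R) : 0 < e ->
  (forall a b : 'rV[R]_n, (forall i, a ord0 i < b ord0 i) ->
    (forall x, S x -> obox a b x -> forall z, obox a b z -> `|z - x| <= e) ->
    (exists2 x, S x & obox a b x) ->
    {ae mu, forall x, obox a b x -> P x}) ->
  {ae mu, forall x, S x -> P x}.
Proof.
move=> e0 H.
pose a (q : 'rV[rat]_n) : 'rV[R]_n := \row_i (ratr (q ord0 i) - e / 2).
pose b (q : 'rV[rat]_n) : 'rV[R]_n := \row_i (ratr (q ord0 i) + e / 2).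
have H1 (q : 'rV[rat]_n) : {ae mu, forall x, S x -> obox (a q) (b q) x -> P x}.
  case: (pselect (exists2 x, S x & obox (a q) (b q) x)) => [ex|nex]; last first.
    by apply: aeW => x Sx qx; exfalso; apply: nex; exists x.
  have /filterS : {ae mu, forall x, obox (a q) (b q) x -> P x}.
    apply: H ex => [i|x _ qx z qz]; first by rewrite !mxE; lra.
    apply/rV_norm_leP; first exact: ltW.
    move=> i; have := qx i; have := qz i; rewrite !mxE ler_norml.
    by move=> /andP[? ?] /andP[? ?]; apply/andP; split; lra.
  by apply => x Hx _; exact: Hx.
have H2 : {ae mu, forall x, forall k : nat,
    if unpickle k is Some q then S x -> obox (a q) (b q) x -> P x else True}.
  apply/ae_foralln => k; case: (unpickle k) => [q|]; first exact: H1.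
  exact: aeW.
apply: filterS H2 => x Hx Sx.
have /choice[q Hq] : forall i, exists q : rat, x ord0 i < ratr q < x ord0 i + e / 2.
  move=> i; have [|q] := @rat_in_itvoo R (x ord0 i) (x ord0 i + e / 2); first lra.
  by rewrite in_itv/=; exists q.
have := Hx (pickle (\row_i q i : 'rV[rat]_n)); rewrite pickleK => /(_ Sx); apply.
by move=> i; rewrite !mxE; have /andP[? ?] := Hq i; apply/andP; split; lra.
Qed.

End Geometry.

(** * Decay of the potential at infinity *)

Section TailDomination.
Context {R : realType} {n : nat}.
Implicit Types (x y z : 'rV[R]_n).
Local Notation mu := (@lebesgue_rV R n).
Variables (alpha M : R) (a01 : 0 < alpha < 1) (n0 : (0 < n)%N) (M1 : 1 <= M).

(* The decay of tker (x - y) in x, uniform for y in a ball around 0. *)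
Definition theta x : R := if `|x| <= M then 1 else `|x| `^ (- (n%:R + alpha)).

Let a0 : 0 < alpha. Proof. by have /andP[] := a01. Qed.
Let na0 : 0 <= n%:R + alpha. Proof. by rewrite addr_ge0// ltW. Qed.

Lemma theta_itv x : 0 <= theta x <= 1.
Proof.
rewrite /theta; case: ifPn => [_|]; first by rewrite ler01 lexx.
rewrite -ltNge => Mx; rewrite powR_ge0/=.
have := powRN_le ltr01 (ltW (le_lt_trans M1 Mx)) na0.
by rewrite powR1.
Qed.

Lemma measurable_theta : measurable_fun setT theta.
Proof.
apply: measurable_fun_ifT => //.
  by apply: measurable_fun_ler => //; exact: measurable_norm_rV.
exact: (measurableT_comp (measurable_powR _) measurable_norm_rV).
Qed.

(** Beyond the radius M >= 1 this function coincides with [kap], so the integral estimate for the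
    kernel also settles the decay at infinity. *)
Lemma integrable_theta : mu.-integrable setT (EFin \o theta).
Proof.
have M0 : 0 <= M by exact: le_trans M1.
have mC := @measurable_cbox R n 0 M.
have mI : measurable_fun setT (fun z : 'rV[R]_n => (\1_(cbox 0 M) z)%:E : \bar R).
  by apply/measurable_EFinP; exact: measurable_indic.
have mk : measurable_fun setT (fun z : 'rV[R]_n => (kap alpha (z - 0))%:E : \bar R).
  apply/measurable_EFinP; apply: (measurableT_comp (measurable_kap alpha)).
  exact: measurable_sub_rV.
have I1 : mu.-integrable setT (fun z : 'rV[R]_n => (\1_(cbox 0 M) z)%:E).
  apply/integrableP; split => //.
  under eq_integral => z _ do rewrite gee0_abs ?lee_fin//.
  by rewrite integral_indic// setIT lebesgue_cbox// ltry.
have I2 : mu.-integrable setT (fun z : 'rV[R]_n => (kap alpha (z - 0))%:E).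
  apply/integrableP; split => //.
  under eq_integral => z _ do rewrite gee0_abs ?lee_fin ?kap_ge0//.
  by apply: le_lt_trans (integral_kap_le _ n0 a01) (ltry _).
apply: (le_integrable measurableT _ _ (integrableD measurableT I1 I2)).
  by apply/measurable_EFinP; exact: measurable_theta.
move=> x _; rewrite /= lee_fin !ger0_norm; last 2 first.
- by rewrite addr_ge0 ?kap_ge0.
- by have /andP[] := theta_itv x.
rewrite /theta indicE subr0; case: ifPn => h.
  by rewrite mem_set ?lerDl ?kap_ge0// /cbox /= subr0.
rewrite -ltNge in h; rewrite /kap min_l ?mul1r ?lerDr//.
exact: le_trans M1 (ltW h).
Qed.

(** For |x| <= M the truncation bound applies. For |x| > M >= 2|y| + 1 one has |x - y| >= |x| / 2,
    whence the factor 2^(n + alpha). *)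
Lemma tker_le_theta eta i x y : 0 < eta -> 2 * `|y| + 1 <= M ->
  `|tker alpha eta i (x - y)| <=
  (@tker_bound R n alpha eta + 2 `^ (n%:R + alpha)) * theta x.
Proof.
move=> eta0 yM; have tb := tker_bound_ge0 (n := n) alpha eta.
have p2 : 0 <= 2 `^ (n%:R + alpha) :> R by exact: powR_ge0.
rewrite /theta; case: ifPn => h.
  by rewrite mulr1; apply: le_trans (tker_le a0 eta0 _ _) _; rewrite lerDl.
rewrite -ltNge in h.
have x0 : 0 < `|x| by apply: lt_trans h; exact: lt_le_trans M1.
have xy : `|x| / 2 <= `|x - y|.
  have := lerB_dist x y; have := normr_ge0 y; lra.
have x20 : 0 < `|x| / 2 by rewrite divr_gt0.
rewrite mulrDl; apply: (@le_trans _ _ (2 `^ (n%:R + alpha) * `|x| `^ (- (n%:R + alpha)))).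
  apply: (@le_trans _ _ (`|x - y| `^ (- (n%:R + alpha)))).
    by rewrite /tker; case: ifP => _; [exact: rker_le|rewrite normr0 powR_ge0].
  apply: le_trans (powRN_le x20 xy na0) _.
  by rewrite powRM// ?invr_ge0// -powR_inv1// -powRrM mulN1r opprK mulrC.
by rewrite lerDr mulr_ge0// powR_ge0.
Qed.

End TailDomination.

(** * Strong convergence *)

Theorem lemma2p12 (R : realType) (n : nat) (hn : (0 < n)%N)
    (alpha p : R) (halpha : 0 < alpha < 1) (hp : 1 <= p)
    (Omega : set 'rV[R]_n) (oOmega : open Omega) (bOmega : bounded_set Omega)
    (g : 'rV[R]_n -> R) (hg : frac_sobolev alpha p g)
    (u_ : nat -> 'rV[R]_n -> R) (u : 'rV[R]_n -> R)
    (hu : weak_cvg_frac_sobolev_bdry alpha p g Omega u_ u)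
    (Omega' : set 'rV[R]_n) (oOmega' : open Omega')
    (hOmega : compactly_contained Omega Omega') :
  strong_cvg_LpV (~` Omega') p
    (fun j => frac_grad alpha (u_ j)) (frac_grad alpha u).
Proof.
have /andP[alpha0 alpha1] := halpha; have p0 : 0 < p by exact: lt_le_trans hp.
have [uj hu0 wu _] := hu.
have mO : measurable Omega by exact: open_measurable_rV.
have mO' : measurable (~` Omega') by apply: measurableC; exact: open_measurable_rV.
have Ofin := lebesgue_bounded_lty mO bOmega.
have [r r0 Or] := bounded_set_cbox bOmega.
have [e e0 He] := compactly_contained_dist oOmega' hOmega.
(* Half of the separation: a box of side [eta] that meets the complement of Omega' stays at distance
   at least e - eta = eta from Omega. *)
pose eta := e / 2; have eta0 : 0 < eta by rewrite divr_gt0.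
(* Existence of some weak gradient is part of membership in the space, so the choice operator
   returns a weak gradient and not its default 0. *)
have weak (f : 'rV[R]_n -> R) : frac_sobolev alpha p f -> is_weak_frac_grad alpha f (frac_grad alpha f).
  by move=> [_ [v hv] _]; apply: (@xgetPex _ (fun=> 0) [set v | is_weak_frac_grad alpha f v]); exists v.
have Lpu : Lp p%:E u by case: hu0 => -[].
have Lpuj j : Lp p%:E (u_ j) by case: (uj j) => -[].
have gu := weak _ hu0.1; have guj j := weak _ (uj j).1.
have mg (f : 'rV[R]_n -> R) : frac_sobolev alpha p f -> measurable_fun setT (frac_grad alpha f).
  by move=> /weak[_ [] ].
have Iu f : Lp p%:E f -> (@lebesgue_rV R n).-integrable Omega (EFin \o f).
  by move=> Lf; exact: Lfun_integrable_in Lf.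
pose w j x := u_ j x - u x.
have Iw j : (@lebesgue_rV R n).-integrable Omega (EFin \o w j).
  by have := integrable_Lp_sub hp mO Ofin (Lpuj j) Lpu.
have wcv (k : 'rV[R]_n -> R) : measurable_fun setT k -> (exists M, forall x, `|k x| <= M) ->
    (fun j => \int[@lebesgue_rV R n]_(x in Omega) (w j x * k x)) @ \oo --> 0.
  move=> mk [M kM]; have := weak_cvg_Lp_pairing hp mO Ofin wu mk kM => cv.
  rewrite -(subrr (\int[@lebesgue_rV R n]_(x in Omega) (u x * k x))).
  rewrite (_ : (fun j => _) = fun j => \int[@lebesgue_rV R n]_(x in Omega) (u_ j x * k x)
    - \int[@lebesgue_rV R n]_(x in Omega) (u x * k x)).
    by apply: cvgB => //; exact: cvg_cst.
  apply/funext => j; rewrite -RintegralB//.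
  - by apply: eq_Rintegral => x _; rewrite mulrBl.
  - exact: (integrableM_bounded mO (Iu _ (Lpuj j)) mk kM).
  - exact: (integrableM_bounded mO (Iu _ Lpu) mk kM).
have [W HW] : exists W, forall j, \int[@lebesgue_rV R n]_(x in Omega) `|w j x| <= W.
  apply: (uniform_boundedness_L1 mO Iw) => k mk kb.
  have [M [_ HM]] := cvg_seq_bounded (cvgP _ (wcv k mk kb)).
  by exists (`|M| + 1) => j; apply: HM; rewrite // (le_lt_trans (ler_norm M))// ltrDl.
(* Since |y| <= r on Omega, this M satisfies 2|y| + 1 <= M there, as [tker_le_theta] requires. *)
pose M := 2 * r + 1; have M1 : 1 <= M by rewrite /M; lra.
pose c := @riesz_cst R n alpha.
pose tail j i x := tail_potential alpha eta (w j) Omega i x.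
have rep : {ae @lebesgue_rV R n, forall x, (~` Omega') x -> forall j i,
    frac_grad alpha (u_ j) x ord0 i - frac_grad alpha u x ord0 i = - c * tail j i x}.
  apply: (ae_rational_box eta0) => a b ab small [x0 Ox0 x0ab].
  have far z y : obox a b z -> Omega y -> eta <= `|z - y|.
    move=> zab Oy; have := small _ Ox0 x0ab _ zab; have := He _ _ Oy Ox0.
    have := ler_distD z x0 y; rewrite (distrC x0 z) /eta; lra.
  (* The indices j and i range over countable sets, so a single null set works for all of them;
     pointwise limits in j then make sense off that set. *)
  have H : {ae @lebesgue_rV R n, forall x, forall j i, obox a b x ->
      frac_grad alpha (u_ j) x ord0 i - frac_grad alpha u x ord0 i = - c * tail j i x}.
    apply/ae_foralln => j; apply: filter_forall => i.
    apply: (weak_frac_grad_diff halpha hp eta0 mO Ofin (Lpuj j) Lpu (guj j) gu _ ab far).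
    by apply: filterS2 (uj j).2 hu0.2 => x h1 h2 Ox; rewrite h1// h2.
  by apply: filterS H => x Hx xab j i; exact: Hx.
have W0 : 0 <= W by apply: le_trans (HW 0%N); exact: Rintegral_ge0.
pose Q0 := @tker_bound R n alpha eta + 2 `^ (n%:R + alpha).
have Q00 : 0 <= Q0 by apply: addr_ge0; [exact: tker_bound_ge0|exact: powR_ge0].
have th0 (x : 'rV[R]_n) : 0 <= theta alpha M x by have /andP[] := @theta_itv R n alpha M halpha M1 x.
have th1 (x : 'rV[R]_n) : theta alpha M x <= 1 by have /andP[] := @theta_itv R n alpha M halpha M1 x.
have tail_le j i x : `|tail j i x| <= Q0 * theta alpha M x * W.
  have Qt0 : 0 <= Q0 * theta alpha M x by rewrite mulr_ge0.
  apply: le_trans (ler_wpM2l Qt0 (HW j)).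
  apply: (tail_potential_le alpha0 eta0 mO (Iw j) Qt0) => y Oy.
  by apply: tker_le_theta => //; have := Or _ Oy; rewrite /M; lra.
have tail_cvg i x : (fun j => tail j i x) @ \oo --> 0.
  apply: wcv; last by exists (@tker_bound R n alpha eta) => y; exact: tker_le.
  apply: (measurableT_comp (measurable_tker alpha eta i)).
  exact: measurable_sub_rV.
pose d j := (enorm \o (frac_grad alpha (u_ j) \- frac_grad alpha u)) \_ (~` Omega').
have md j : measurable_fun setT (d j).
  apply: (measurable_restrictT _ mO').1; apply: measurable_funTS.
  apply: (measurableT_comp (@measurable_enorm R n)).
  by apply: measurable_sub_rV; apply: mg; [case: (uj j)|case: hu0].
have d0 j x : 0 <= d j x.
  by rewrite /d patchE; case: ifP => // _; exact: enorm_ge0.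
have d_le x : ((~` Omega') x -> forall j i,
    frac_grad alpha (u_ j) x ord0 i - frac_grad alpha u x ord0 i = - c * tail j i x) ->
    forall j, d j x <= Num.sqrt n%:R * \sum_i `|c| * `|tail j i x|.
  move=> Hx j; rewrite /d patchE; case: ifPn => [|_]; last first.
    by rewrite mulr_ge0 ?sqrtr_ge0// sumr_ge0// => i _; rewrite mulr_ge0.
  rewrite inE => Ox; apply: le_trans (enorm_le _) _.
  rewrite ler_wpM2l ?sqrtr_ge0//; apply: ler_sum => i _.
  by rewrite !mxE Hx// normrM normrN.
(* The factor sqrt n comes from [enorm_le], n from the number of coordinates, and Q0 W from
   [tail_le]. *)
pose Q := Num.sqrt n%:R * (n%:R * (`|c| * (Q0 * W))).
have Qge0 : 0 <= Q by rewrite !mulr_ge0// sqrtr_ge0.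
have E0 : (fun j => \int[@lebesgue_rV R n]_x (`|d j x| `^ p)%:E)%E @ \oo --> 0%E.
  have mdp j : measurable_fun setT (fun x => (`|d j x| `^ p)%:E).
    apply/measurable_EFinP; apply: (measurableT_comp (measurable_powR _)).
    exact: measurableT_comp.
  (* The p-th powers are dominated by (Q theta)^p, and theta^p <= theta because theta lies in [0, 1]
     and p >= 1; integrability of [theta] thus suffices for every p. *)
  have [] := @dominated_convergence _ _ _ (@lebesgue_rV R n) setT measurableT
    (fun j x => (`|d j x| `^ p)%:E) (cst 0%E) (fun x => (Q `^ p * theta alpha M x)%:E) mdp _ _ _ _.
  - exact: measurable_cst.
  - apply: filterS rep => x Hx _; apply: cvg_EFin; first exact: nearW.
    apply: powR_cvg0_seq => //.
    have ci (i : 'I_n) : (fun j => `|c| * `|tail j i x|) @ \oo --> (0 : R).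
      rewrite -[X in _ --> X](mulr0 `|c|); apply: cvgMl_tmp; apply/norm_cvg0P.
      exact: tail_cvg.
    have cs := @cvg_big R^o 'I_n +%R 0 xpredT (@add_continuous R^o) nat \oo
      (index_enum 'I_n) (fun i j => `|c| * `|tail j i x|) (fun=> 0) _ (fun i _ => ci i).
    have cc := cvgMl_tmp (a := Num.sqrt n%:R) (cs _).
    rewrite big1 ?mulr0 in cc; last by [].
    apply: (squeeze_cvgr _ (cvg_cst 0) (cc _ _)); apply: nearW => j.
    by rewrite normr_ge0 ger0_norm//; exact: d_le.
  - exact: (integrableZl measurableT (Q `^ p) (integrable_theta halpha hn M1)).
  - apply: filterS rep => x Hx j _; rewrite /= lee_fin ger0_norm ?powR_ge0// ger0_norm//.
    apply: (@le_trans _ _ ((Q * theta alpha M x) `^ p)).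
      apply: ge0_ler_powR; rewrite ?nnegrE ?mulr_ge0//; first exact: ltW.
      apply: le_trans (d_le x Hx j) _; rewrite /Q -mulrA ler_wpM2l ?sqrtr_ge0//.
      rewrite -mulrA [n%:R * _](_ : _ = \sum_(i < n) (`|c| * (Q0 * theta alpha M x * W))).
        by apply: ler_sum => i _; rewrite ler_wpM2l.
      by rewrite sumr_const card_ord -mulr_natl; ring.
    rewrite powRM// ler_wpM2l ?powR_ge0//.
    have [->|tn0] := eqVneq (theta alpha M x) 0; first by rewrite powR0// gt_eqF.
    by apply: ge1r_powR => //; rewrite lt_def tn0 th0 th1.
  by rewrite integral0.
(* Convergence to 0 makes the extended-real integrals finite from some rank on; from there the norm
   is the real p-th root of the integral, and the two sequences are compared eventually. *)
have [fE cE] := (fine_cvgP _ _).1 E0.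
have cF : (fun j => (fine (\int[@lebesgue_rV R n]_x (`|d j x| `^ p)%:E) `^ p^-1)%:E)%E @ \oo --> 0%E.
  apply: cvg_EFin; first exact: nearW.
  apply: powR_cvg0_seq => //; first by rewrite invr_gt0.
  by move=> j; rewrite fine_ge0// integral_ge0// => x _; rewrite lee_fin powR_ge0.
rewrite /strong_cvg_LpV; apply: cvg_trans cF; apply: near_eq_cvg.
near=> j; rewrite /LpV_norm unlock /= -poweR_EFin fineK; last by near: j.
by congr (_ `^ _)%E; apply: eq_integral => x _; rewrite poweR_EFin.
Unshelve. all: by end_near. Qed.
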